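(* Let $PW=\{F\in L^2(\mathbb R):\operatorname{supp}\widehat F\subset[-1/2,1/2]\}$. The map $F\mapsto\big(\{F(n)\}_{n\ge0},\{-\tfrac{1}{2\pi i}F'(n)\}_{n<0}\big)$ on $PW$ is injective, but it is not stable: there is no $c>0$ such that $\sum_{n\ge0}|F(n)|^2+\sum_{n<0}\big|\tfrac{-1}{2\pi i}F'(n)\big|^2\ge c\|F\|_{L^2(\mathbb R)}^2$ for all $F\in PW$.
   Context: Functions in $PW$ are entire (continuous, differentiable) and are of the form $F(\xi)=\int_{-1/2}^{1/2}f(x)e^{-2\pi i\xi x}dx$ with $f\in L^2[-1/2,1/2]$; $n$ ranges over the integers. *)

(* Defs.v *)
(* Complex-valued functions are represented by
   pairs (real part, imaginary part) of real functions. *)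
From HB Require Import structures.
From mathcomp Require Import all_boot all_order all_algebra.
From mathcomp Require Import all_classical all_reals all_analysis.
Set Implicit Arguments. Unset Strict Implicit. Unset Printing Implicit Defensive.
Import Order.TTheory GRing.Theory Num.Theory.
Import numFieldNormedType.Exports.
Local Open Scope classical_set_scope.
Local Open Scope ring_scope.

Section PW.
Variable R : realType.

Definition leb := (@lebesgue_measure R).

Definition Ihalf : set R := `[(- (1/2)), (1/2)]%classic.

Definition L2_half (f : R -> R) : Prop :=
  measurable_fun Ihalf f /\ (\int[leb]_(x in Ihalf) ((f x) ^+ 2)%:E < +oo)%E.

(* Fourier transform of f = fr + i fi restricted to [-1/2,1/2]:
   F(xi) = int_{-1/2}^{1/2} f(x) e^{-2 pi i xi x} dx,
   e^{-2 pi i xi x} = cos(2 pi xi x) - i sin(2 pi xi x). *)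
Definition FT_re (fr fi : R -> R) (xi : R) : R :=
  Rintegral leb Ihalf (fun x => fr x * cos (2 * pi * xi * x) + fi x * sin (2 * pi * xi * x)).
Definition FT_im (fr fi : R -> R) (xi : R) : R :=
  Rintegral leb Ihalf (fun x => fi x * cos (2 * pi * xi * x) - fr x * sin (2 * pi * xi * x)).

Definition in_PW (Fr Fi : R -> R) : Prop :=
  exists fr fi : R -> R, [/\ L2_half fr, L2_half fi,
    Fr = FT_re fr fi & Fi = FT_im fr fi].

Definition cabs2 (Fr Fi : R -> R) (x : R) : R := (Fr x) ^+ 2 + (Fi x) ^+ 2.

(* |-1/(2 pi i) F'(x)|^2 = |F'(x)|^2 / (2 pi)^2 *)
Definition dabs2 (Fr Fi : R -> R) (x : R) : R :=
  ((derive1 Fr x) ^+ 2 + (derive1 Fi x) ^+ 2) / (2 * pi) ^+ 2.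

Definition L2norm2 (Fr Fi : R -> R) : \bar R :=
  (\int[leb]_(x in [set: R]) (cabs2 Fr Fi x)%:E)%E.

Definition sample_energy (Fr Fi : R -> R) : \bar R :=
  (\sum_(0 <= n <oo) (cabs2 Fr Fi n%:R)%:E
   + \sum_(0 <= k <oo) (dabs2 Fr Fi (- (k.+1)%:R))%:E)%E.

End PW.

(* Main.v *)
(** Write [e_n] for the character [exp(2 pi i n x)] on [-1/2, 1/2].  If [F] is the
    transform of [f], then [F(n)] and [-F'(n) / (2 pi i)] are the [n]-th Fourier
    coefficients of [f] and of [x f].

    Injectivity: suppose that [f] has coefficients only at [n < 0] and [x f] only
    at [n >= 0].  Since [f] is an [L^2] limit of trigonometric polynomials with
    negative frequencies, so is [i e_(-1) f], and therefore
    [0 = Re <x f, i e_(-1) f>], which is the integral of [x sin(2 pi x) |f|^2].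
    As [x sin(2 pi x) > 0] for almost every [x] in [-1/2, 1/2], [f] vanishes.

    Instability: for [f = e_(-1) + ... + e_(-N)] we have [|f| <= 1 / |sin(pi x)|],
    hence [|x f| <= 1].  By Bessel's inequality the sample energy is at most [1],
    and the derivative of [Re F] is bounded by [2 pi]; as [F(-k) = 1] for
    [1 <= k <= N], the norm of [F] grows linearly with [N]. *)

Require Import Defs.
From HB Require Import structures.
From mathcomp Require Import all_boot all_order all_algebra.
From mathcomp Require Import all_classical all_reals all_analysis measurable_realfun.
From mathcomp Require Import ring lra.

Set Implicit Arguments. Unset Strict Implicit. Unset Printing Implicit Defensive.
Import Order.TTheory GRing.Theory Num.Theory.
Import numFieldNormedType.Exports.
Local Open Scope classical_set_scope.
Local Open Scope ring_scope.

(** * Integration over [-1/2, 1/2] *)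

Section IntegralHalf.
Variable R : realType.
Implicit Types f g : R -> R.
Local Notation mu := (@lebesgue_measure R).

(* The same set, viewed in the domain type of the Lebesgue measure. *)
Local Notation IR := (@Ihalf R : set (measurableTypeR R)).

Definition itgI f : Prop := mu.-integrable IR (EFin \o f).
Definition intI f : R := Rintegral mu IR f.

Lemma measurable_Ihalf : measurable IR.
Proof. exact: measurable_itv. Qed.
Hint Resolve measurable_Ihalf : core.

Lemma IhalfP (x : R) : Ihalf x <-> - (1/2) <= x <= 1/2.
Proof. by rewrite /Ihalf /= in_itv. Qed.

Lemma mu_Ihalf : mu IR = 1%E.
Proof.
rewrite /Ihalf lebesgue_measure_itv /= lte_fin ifT; last by lra.
by rewrite -EFinB; congr (_%:E); lra.
Qed.

Lemma itgI_measurable f : itgI f -> measurable_fun IR f.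
Proof. by case/integrableP => /measurable_EFinP. Qed.

Lemma itgI_dom f g : measurable_fun IR f ->
  (forall x, Ihalf x -> `|f x| <= g x) -> itgI g -> itgI f.
Proof.
move=> mf fg; apply: le_integrable => //; first exact/measurable_EFinP.
by move=> x /fg fgx; rewrite /= lee_fin (le_trans fgx)// ler_norm.
Qed.

Lemma itgI_cst (C : R) : itgI (fun=> C).
Proof.
apply: measurable_bounded_integrable => //; last exact: bounded_cst.
by rewrite [X in (X < _)%E]mu_Ihalf ltry.
Qed.

Lemma itgI_bounded f (C : R) : measurable_fun IR f ->
  (forall x, Ihalf x -> `|f x| <= C) -> itgI f.
Proof. by move=> mf fC; apply: itgI_dom fC (itgI_cst C). Qed.

Lemma itgID f g : itgI f -> itgI g -> itgI (fun x => f x + g x).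
Proof. by move=> fi gi; exact: (integrableD measurable_Ihalf fi gi). Qed.

Lemma itgIZ c f : itgI f -> itgI (fun x => c * f x).
Proof. by move=> fi; exact: (integrableZl measurable_Ihalf c fi). Qed.

Lemma eq_intI f g : (forall x, Ihalf x -> f x = g x) -> intI f = intI g.
Proof. by move=> fg; apply: eq_Rintegral => x /set_mem /fg. Qed.

Lemma intID f g : itgI f -> itgI g ->
  intI (fun x => f x + g x) = intI f + intI g.
Proof. by move=> fi gi; exact: RintegralD. Qed.

Lemma intIZ c f : itgI f -> intI (fun x => c * f x) = c * intI f.
Proof. by move=> fi; exact: RintegralZl. Qed.

Lemma intI_cst (C : R) : intI (fun=> C) = C.
Proof. by rewrite /intI Rintegral_cst// [X in fine X]mu_Ihalf mulr1. Qed.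

Lemma le_intI f g : itgI f -> itgI g ->
  (forall x, Ihalf x -> f x <= g x) -> intI f <= intI g.
Proof. by move=> fi gi fg; exact: le_Rintegral. Qed.

Lemma intI_ge0 f : (forall x, Ihalf x -> 0 <= f x) -> 0 <= intI f.
Proof. by move=> f0; rewrite /intI; apply: Rintegral_ge0. Qed.

Lemma abs_intI_le f g : itgI f -> itgI g ->
  (forall x, Ihalf x -> `|f x| <= g x) -> `|intI f| <= intI g.
Proof.
move=> fi gi fg; rewrite ler_norml; apply/andP; split.
  rewrite lerNl -mulN1r -intIZ//; apply: le_intI => //; first exact: itgIZ.
  by move=> x /fg; rewrite ler_norml mulN1r lerNl => /andP[].
by apply: le_intI => // x /fg; rewrite ler_norml => /andP[].
Qed.

Lemma intI_sum n (F : nat -> R -> R) : (forall k, itgI (F k)) ->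
  itgI (fun x => \sum_(k < n) F k x) /\
  intI (fun x => \sum_(k < n) F k x) = \sum_(k < n) intI (F k).
Proof.
move=> Fi; elim: n => [|n [IHi IH]].
  split; first by under eq_fun do rewrite big_ord0; exact: itgI_cst.
  by under eq_fun do rewrite big_ord0; rewrite big_ord0 intI_cst.
under eq_fun do rewrite big_ord_recr /=.
by rewrite big_ord_recr /= -IH; split; [exact: itgID|exact: intID].
Qed.

Lemma intI_EFin f : itgI f ->
  (\int[mu]_(x in IR) (f x)%:E)%E = (intI f)%:E.
Proof. by move=> fi; rewrite fineK//; exact: integrable_fin_num. Qed.

(** * Square integrable functions *)

Lemma L2_halfP f :
  L2_half f <-> measurable_fun IR f /\ itgI (fun x => f x ^+ 2).
Proof.
split=> -[mf]; last first.
  move=> /integrableP[_ fi]; split => //; apply: le_lt_trans fi.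
  rewrite le_eqVlt; apply/orP; left; apply/eqP; apply: eq_integral => x _ /=.
  by rewrite ger0_norm// sqr_ge0.
move=> fi; split => //; apply/integrableP; split.
  exact/measurable_EFinP/measurable_funX.
apply: le_lt_trans fi; rewrite le_eqVlt; apply/orP; left; apply/eqP.
by apply: eq_integral => x _ /=; rewrite ger0_norm// sqr_ge0.
Qed.

Lemma L2_measurable f : L2_half f -> measurable_fun IR f.
Proof. by case. Qed.

Lemma L2_sqr f : L2_half f -> itgI (fun x => f x ^+ 2).
Proof. by case/L2_halfP. Qed.

Lemma L2_mul f g : L2_half f -> L2_half g -> itgI (fun x => f x * g x).
Proof.
move=> /L2_halfP[mf f2] /L2_halfP[mg g2].
apply: (@itgI_dom _ (fun x => f x ^+ 2 + g x ^+ 2)); last exact: itgID.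
  exact: measurable_funM.
move=> x _; rewrite ler_norml; apply/andP; split; nra.
Qed.

Lemma L2D f g : L2_half f -> L2_half g -> L2_half (fun x => f x + g x).
Proof.
move=> /L2_halfP[mf f2] /L2_halfP[mg g2]; apply/L2_halfP.
have mfg : measurable_fun IR (fun x => f x + g x).
  exact: measurable_funD.
split => //.
apply: (@itgI_dom _ (fun x => 2 * (f x ^+ 2 + g x ^+ 2))).
- exact: measurable_funX.
- by move=> x _; rewrite ger0_norm ?sqr_ge0//; have := sqr_ge0 (f x - g x); nra.
- by apply: itgIZ; exact: itgID.
Qed.

Lemma L2_bounded f (C : R) : measurable_fun IR f ->
  (forall x, Ihalf x -> `|f x| <= C) -> L2_half f.
Proof.
move=> mf fC; apply/L2_halfP; split => //.
apply: (@itgI_bounded _ (C ^+ 2)); first exact: measurable_funX.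
by move=> x /fC fx; rewrite normrX ler_pXn2r// nnegrE (le_trans _ fx).
Qed.

Lemma L2_mulb (b f : R -> R) (C : R) : measurable_fun IR b ->
  (forall x, Ihalf x -> `|b x| <= C) -> L2_half f ->
  L2_half (fun x => b x * f x).
Proof.
move=> mb bC /L2_halfP[mf f2]; apply/L2_halfP.
have mbf : measurable_fun IR (fun x => b x * f x).
  exact: measurable_funM.
split => //; apply: (@itgI_dom _ (fun x => C ^+ 2 * (f x ^+ 2))).
- exact: measurable_funX.
- move=> x /bC bx; rewrite normrX normrM exprMn real_normK ?num_real//.
  rewrite real_normK ?num_real// ler_wpM2r ?sqr_ge0//.
  by rewrite -[b x ^+ 2]real_normK ?num_real// ler_pXn2r// nnegrE (le_trans _ bx).
- exact: itgIZ.
Qed.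

Lemma L2Z c f : L2_half f -> L2_half (fun x => c * f x).
Proof. by apply: (@L2_mulb _ _ `|c|) => //. Qed.

Lemma L2B f g : L2_half f -> L2_half g -> L2_half (fun x => f x - g x).
Proof.
move=> f2 g2; have -> : (fun x => f x - g x) = (fun x => f x + -1 * g x).
  by apply/funext => x; rewrite mulN1r.
by apply: L2D => //; exact: L2Z.
Qed.

Lemma L2_cst c : L2_half (fun=> c : R).
Proof. exact: (@L2_bounded _ `|c|). Qed.

Lemma L2_itg f : L2_half f -> itgI f.
Proof.
move=> f2; have := L2_mul f2 (L2_cst 1).
by under eq_fun do rewrite mulr1.
Qed.

End IntegralHalf.
#[global] Hint Resolve measurable_Ihalf : core.

(** * Characters and the inner product of pairs *)

Section Characters.
Variable R : realType.
Local Notation mu := (@lebesgue_measure R).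
Local Notation IR := (@Ihalf R : set (measurableTypeR R)).
Implicit Types (u v w : R -> R * R) (x t xi : R) (n m : int).

Lemma continuous_measI (f : R -> R) : continuous f -> measurable_fun IR f.
Proof. by move=> /continuous_measurable_fun; exact: measurable_funTS. Qed.

Lemma continuous_affine (a t : R) : continuous (fun x : R => a * x + t).
Proof.
move=> x; apply: cvgD; last exact: cvg_cst.
by apply: cvgM; [exact: cvg_cst|exact: cvg_id].
Qed.

Lemma continuous_cos_affine (a t : R) : continuous (fun x : R => cos (a * x + t)).
Proof.
move=> x; apply: (@continuous_comp _ _ _ (fun x => a * x + t) (@cos R)).
  exact: continuous_affine.
exact: continuous_cos.
Qed.

Lemma continuous_sin_affine (a t : R) : continuous (fun x : R => sin (a * x + t)).
Proof.
move=> x; apply: (@continuous_comp _ _ _ (fun x => a * x + t) (@sin R)).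
  exact: continuous_affine.
exact: continuous_sin.
Qed.

Lemma is_derive_affine (a t x : R) : is_derive x 1 (fun x : R => a * x + t) a.
Proof. by apply: is_derive_eq; rewrite addr0 -[_%:A]/(_ * _) mulr1. Qed.

Lemma is_derive_sin_affine (a t x : R) :
  is_derive x 1 (fun x : R => sin (a * x + t)) (a * cos (a * x + t)).
Proof.
have := @is_derive1_comp _ (@sin R) (fun x => a * x + t) x _ _
  (is_derive_sin (a * x + t)) (is_derive_affine a t x).
by rewrite mulrC.
Qed.

Lemma is_derive_cos_affine (a t x : R) :
  is_derive x 1 (fun x : R => cos (a * x + t)) (- a * sin (a * x + t)).
Proof.
have := @is_derive1_comp _ (@cos R) (fun x => a * x + t) x _ _
  (is_derive_cos (a * x + t)) (is_derive_affine a t x).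
by rewrite mulrC mulNr mulrN.
Qed.

Lemma sin_pi_int n : sin (pi * n%:~R) = 0 :> R.
Proof.
have sn k : sin (pi * k%:R) = 0 :> R.
  elim: k => [|k IH]; first by rewrite mulr0 sin0.
  by rewrite -natr1 mulrDr mulr1 sinDpi IH oppr0.
case: n => k; first exact: sn.
by rewrite NegzE mulrNz mulrN sinN [X in sin X](_ : _ = pi * k.+1%:R)// sn oppr0.
Qed.

(** The free phase [t] treats sine and cosine together. For n <> 0 the primitive sin(a x + t) / a
    takes equal values at both endpoints, because a / 2 = pi n. *)
Lemma intI_cos n t :
  intI (fun x => cos (2 * pi * n%:~R * x + t)) = if n == 0 then cos t else 0.
Proof.
have [->|n0] := eqVneq n 0.
  rewrite -[RHS](intI_cst (cos t)); apply: eq_intI => x _.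
  by rewrite mulr0z mulr0 mul0r add0r.
set a := 2 * pi * n%:~R : R.
have a0 : a != 0.
  by rewrite !mulf_neq0// ?intr_eq0// gt_eqF// pi_gt0.
have dF x : is_derive x 1 (fun x => a^-1 * sin (a * x + t)) (cos (a * x + t)).
  have H := is_derive_sin_affine a t x.
  by apply: is_derive_eq; rewrite -[_ *: _]/(_ * _) mulKf.
have cF x : {for x, continuous (fun x => a^-1 * sin (a * x + t))}.
  by apply: differentiable_continuous; apply/derivable1_diffP; case: (dF x).
rewrite /intI /Rintegral /Ihalf.
rewrite (@continuous_FTC2 _ _ (fun x => a^-1 * sin (a * x + t))); last 4 first.
- lra.
- by apply: continuous_subspaceT => x; exact: continuous_cos_affine.
- split; first by move=> x _; case: (dF x).
    by apply: cvg_at_right_filter; exact: cF.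
  by apply: cvg_at_left_filter; exact: cF.
- by move=> x _; rewrite derive1E; case: (dF x).
rewrite -EFinB /= -mulrBr.
have -> : a * (1 / 2) = pi * n%:~R by rewrite /a; field.
have -> : a * - (1 / 2) = - (pi * n%:~R) by rewrite /a; field.
by rewrite !sinD sinN cosN sin_pi_int; ring.
Qed.

End Characters.

(** * The real inner product and trigonometric polynomials with restricted frequencies *)

Section PairSpace.
Variable R : realType.
Local Notation IR := (@Ihalf R : set (measurableTypeR R)).
Implicit Types (u v w p q r : R -> R * R) (x t xi c : R) (n m : int).

(** A single operation serves for all linear combinations: [lin 1 u v] is the sum and [lin (-1) u v]
    is v - u. *)
Definition lin c u v : R -> R * R :=
  fun x => (c * (u x).1 + (v x).1, c * (u x).2 + (v x).2).

(** The real part of a times the conjugate of b, so that [ip] is the real part of the Hermitian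
    product of L^2. *)
Definition dot (a b : R * R) : R := a.1 * b.1 + a.2 * b.2.

Definition ip u v : R := intI (fun x => dot (u x) (v x)).

Definition L2V u : Prop :=
  L2_half (fun x => (u x).1) /\ L2_half (fun x => (u x).2).

(* The function [exp(i (2 pi xi x + t))], as a pair. *)
Definition chi xi t : R -> R * R :=
  fun x => (cos (2 * pi * xi * x + t), sin (2 * pi * xi * x + t)).

Lemma L2V_lin c u v : L2V u -> L2V v -> L2V (lin c u v).
Proof. by move=> [u1 u2] [v1 v2]; split; apply: L2D => //; exact: L2Z. Qed.

Lemma L2V_chi xi t : L2V (chi xi t).
Proof.
split; apply: (@L2_bounded _ _ 1).
- by apply: continuous_measI; exact: continuous_cos_affine.
- by move=> x _; exact: cos_max.
- by apply: continuous_measI; exact: continuous_sin_affine.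
- by move=> x _; exact: sin_max.
Qed.

Lemma itgI_dot u v : L2V u -> L2V v -> itgI (fun x => dot (u x) (v x)).
Proof. by move=> [u1 u2] [v1 v2]; apply: itgID; exact: L2_mul. Qed.

Lemma ipC u v : ip u v = ip v u.
Proof. by apply: eq_intI => x _; rewrite /dot mulrC [X in _ + X]mulrC. Qed.

Lemma ip_linl c u v w : L2V u -> L2V v -> L2V w ->
  ip (lin c u v) w = c * ip u w + ip v w.
Proof.
move=> u2 v2 w2; have iu := itgI_dot u2 w2; have iv := itgI_dot v2 w2.
rewrite /ip -(intIZ _ iu) -(intID (itgIZ _ iu) iv).
by apply: eq_intI => x _; rewrite /dot/=; ring.
Qed.

Lemma ip_linr c u v w : L2V u -> L2V v -> L2V w ->
  ip w (lin c u v) = c * ip w u + ip w v.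
Proof. by move=> *; rewrite ipC ip_linl// !(ipC w). Qed.

Lemma ip_ge0 u : 0 <= ip u u.
Proof. by apply: intI_ge0 => x _; rewrite /dot -!expr2 addr_ge0// sqr_ge0. Qed.

Lemma ip_chi n m t s : ip (chi n%:~R t) (chi m%:~R s) =
  if n == m then cos (t - s) else 0.
Proof.
rewrite -subr_eq0 -intI_cos; apply: eq_intI => x _.
rewrite /dot /= -cosB intrB; congr cos; ring.
Qed.

Lemma ip0r w : ip w (fun=> (0, 0)) = 0.
Proof.
by rewrite -[RHS](intI_cst (0 : R)); apply: eq_intI => x _; rewrite /dot /=; ring.
Qed.

(** A phase pi/2 multiplies the character by i. The phases 0 and pi/2 thus give the real and
    imaginary parts of a Fourier coefficient, and these determine the products with all other
    phases. *)
Lemma ip_chi_phase u xi t : L2V u ->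
  ip u (chi xi t) = cos t * ip u (chi xi 0) + sin t * ip u (chi xi (pi / 2)).
Proof.
move=> u2.
have z2 : L2V (fun=> (0, 0)) by split; exact: L2_cst.
have -> : ip u (chi xi t) =
    ip u (lin (cos t) (chi xi 0) (lin (sin t) (chi xi (pi / 2)) (fun=> (0, 0)))).
  apply: eq_intI => x _; rewrite /dot /lin /chi /= !cosD !sinD.
  by rewrite cos0 sin0 cos_pihalf sin_pihalf; ring.
have c1 := L2V_chi xi 0; have c2 := L2V_chi xi (pi / 2).
by rewrite (ip_linr _ c1 (L2V_lin _ c2 z2) u2) (ip_linr _ c2 z2 u2) ip0r addr0.
Qed.

(** Coefficients are real, but since every phase is allowed this is the complex span of the
    characters with frequency in [P]. *)
Inductive trigV (P : int -> Prop) : (R -> R * R) -> Prop :=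
| trigV0 : trigV P (fun=> (0, 0))
| trigV_lin c n t u : P n -> trigV P u -> trigV P (lin c (chi n%:~R t) u).

Lemma trigV_L2 P u : trigV P u -> L2V u.
Proof.
elim=> [|c n t v _ _ IH]; first by split; exact: L2_cst.
by apply: L2V_lin => //; exact: L2V_chi.
Qed.

Lemma trigV_orth P u w : trigV P u -> L2V w ->
  (forall n t, P n -> ip w (chi n%:~R t) = 0) -> ip w u = 0.
Proof.
move=> + w2 wP; elim=> [|c n t v Pn Pv IH]; first exact: ip0r.
rewrite ip_linr//; [|exact: L2V_chi|exact: trigV_L2 Pv].
by rewrite wP// IH mulr0 addr0.
Qed.

Lemma lin1_linl c u v w : lin 1 (lin c u v) w = lin c u (lin 1 v w).
Proof. by apply/funext => x; rewrite /lin /=; congr pair; ring. Qed.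

Lemma lin1_linr c u v w : lin 1 v (lin c u w) = lin c u (lin 1 v w).
Proof. by apply/funext => x; rewrite /lin /=; congr pair; ring. Qed.

Lemma trigVD P u v : trigV P u -> trigV P v -> trigV P (lin 1 u v).
Proof.
move=> + Pv; elim=> [|c n t w Pn Pw IH].
  by rewrite (_ : lin _ _ _ = v)//; apply/funext => x;
    rewrite /lin /= mulr0 !add0r; case: (v x).
by rewrite lin1_linl; exact: trigV_lin.
Qed.

Lemma trigV_split (P : pred int) u : trigV (fun=> True) u ->
  exists q r, [/\ trigV P q, trigV (fun n => ~~ P n) r & u = lin 1 q r].
Proof.
elim=> [|c n t v _ _ [q [r [Pq Pr ->]]]].
  exists (fun=> (0, 0)), (fun=> (0, 0)); split; [exact: trigV0..|].
  by apply/funext => x; rewrite /lin /= mulr0 addr0.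
have [Pn|Pn] := boolP (P n).
  exists (lin c (chi n%:~R t) q), r; split => //; first exact: trigV_lin.
  by rewrite lin1_linl.
exists q, (lin c (chi n%:~R t) r); split => //; first exact: trigV_lin.
by rewrite lin1_linr.
Qed.

(* [r] is orthogonal to [v - q], so dropping it from an approximation [q + r]
   of [v] can only bring the approximation closer. *)
Lemma trigV_project (P : pred int) v u : L2V v ->
  (forall n t, ~~ P n -> ip v (chi n%:~R t) = 0) -> trigV (fun=> True) u ->
  exists2 q, trigV P q & ip (lin (-1) q v) (lin (-1) q v) <=
                         ip (lin (-1) u v) (lin (-1) u v).
Proof.
move=> v2 vP /(trigV_split P) [q [r [Pq Pr ->]]]; exists q => //.
have q2 := trigV_L2 Pq; have r2 := trigV_L2 Pr.
have vr : ip v r = 0 by apply: trigV_orth Pr v2 _ => n t; exact: vP.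
have qr : ip q r = 0.
  apply: (trigV_orth Pr) => // n t Pn; rewrite ipC.
  apply: (trigV_orth Pq) => [|m s Pm]; first exact: L2V_chi.
  by rewrite ip_chi; case: eqP => // nm; move: Pn; rewrite /= nm Pm.
set w := lin (-1) q v; have w2 : L2V w by exact: L2V_lin.
have -> : lin (-1) (lin 1 q r) v = lin (-1) r w.
  by apply/funext => x; rewrite /w /lin /=; congr pair; ring.
have wr : ip w r = 0 by rewrite ip_linl// qr vr; ring.
clearbody w; rewrite (ip_linl _ r2 w2 (L2V_lin _ r2 w2)).
rewrite (ip_linr _ r2 w2 r2) (ip_linr _ r2 w2 w2) (ipC r w) wr; have := ip_ge0 r; lra.
Qed.

(** Expand the squares (e y + z)^2 / e >= 0 and (e y - z)^2 / e >= 0 in each coordinate. *)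
Lemma dot_le_sqr (e : R) (a b : R * R) : 0 < e ->
  `|dot a b| <= e * dot a a + e^-1 * dot b b.
Proof.
move=> e0; have ee : e * e^-1 = 1 by rewrite divff// gt_eqF.
have H (y z : R) : `|y * z| <= e * (y * y) + e^-1 * (z * z).
  have : 0 <= e^-1 * (e * y - z) ^+ 2.
    by rewrite mulr_ge0 ?sqr_ge0// invr_ge0 ltW.
  have : 0 <= e^-1 * (e * y + z) ^+ 2.
    by rewrite mulr_ge0 ?sqr_ge0// invr_ge0 ltW.
  have -> : e^-1 * (e * y + z) ^+ 2 = e * (y * y) + e^-1 * (z * z) + 2 * (y * z).
    by field; rewrite gt_eqF.
  have -> : e^-1 * (e * y - z) ^+ 2 = e * (y * y) + e^-1 * (z * z) - 2 * (y * z).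
    by field; rewrite gt_eqF.
  have : 0 <= e * (y * y) + e^-1 * (z * z).
    by rewrite addr_ge0// mulr_ge0 ?invr_ge0 -?expr2 ?sqr_ge0// ltW.
  move=> *; rewrite ler_norml; apply/andP; split; lra.
rewrite /dot (le_trans (ler_normD _ _))// (le_trans (lerD (H _ _) (H _ _)))//.
by rewrite !mulrDr addrACA.
Qed.

(** A substitute for the Cauchy-Schwarz inequality without square roots; the weight [e] is chosen at
    the point of use. *)
Lemma ip_le_sqr (e : R) u v : 0 < e -> L2V u -> L2V v ->
  `|ip u v| <= e * ip u u + e^-1 * ip v v.
Proof.
move=> e0 u2 v2; rewrite /ip.
rewrite -intIZ; last exact: itgI_dot.
rewrite -intIZ; last exact: itgI_dot.
rewrite -intID; [|apply: itgIZ; exact: itgI_dot..].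
have i1 := itgI_dot u2 v2.
have i2 : itgI (fun x => e * dot (u x) (u x) + e^-1 * dot (v x) (v x)).
  by apply: itgID; apply: itgIZ; exact: itgI_dot.
by apply: abs_intI_le => // x _; exact: dot_le_sqr.
Qed.

End PairSpace.

(** * The Fejer kernel *)

Section Fejer.
Variable R : realType.
Local Notation IR := (@Ihalf R : set (measurableTypeR R)).
Implicit Types (f g : R -> R) (x y z t c : R) (n m : int) (N : nat).

(** [dirC] and [dirS] are the real and imaginary parts of w (1 + z + ... + z^(N-1)) with z = exp(i
    theta) and w = exp(i t). *)
Definition dirC N (theta t : R) : R := \sum_(k < N) cos (k%:R * theta + t).
Definition dirS N (theta t : R) : R := \sum_(k < N) sin (k%:R * theta + t).

(* Real and imaginary parts of the geometric sum
   [(1 - z) (1 + z + ... + z^(N-1)) w = w - z^N w] on the unit circle. *)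
Lemma dirichlet_telescope N (theta t : R) :
  dirC N theta t - (dirC N theta t * cos theta - dirS N theta t * sin theta)
    = cos t - cos (N%:R * theta + t) /\
  dirS N theta t - (dirC N theta t * sin theta + dirS N theta t * cos theta)
    = sin t - sin (N%:R * theta + t).
Proof.
rewrite /dirC /dirS; elim: N => [|N [IH1 IH2]].
  by rewrite !big_ord0 !mul0r !add0r; split; ring.
have e : N.+1%:R * theta + t = (N%:R * theta + t) + theta.
  by rewrite -natr1; ring.
rewrite !big_ord_recr /= e.
rewrite (cosD (N%:R * theta + t)) (sinD (N%:R * theta + t)).
move: IH1 IH2; rewrite -/(dirC N theta t) -/(dirS N theta t).
set C := dirC _ _ _; set S := dirS _ _ _.
set a := N%:R * theta + t => IH1 IH2; split.
  transitivity (C - (C * cos theta - S * sin theta)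
    + (cos a - (cos a * cos theta - sin a * sin theta))); first by ring.
  by rewrite IH1; ring.
transitivity (S - (C * sin theta + S * cos theta)
  + (sin a - (cos a * sin theta + sin a * cos theta))); first by ring.
by rewrite IH2; ring.
Qed.

(** Take squared moduli in the geometric sum: |1 - z|^2 = 2 (1 - cos theta) and |w - z^N w|^2 = 2 (1
    - cos (N theta)). This gives both the decay of the Fejer kernel and the bound on [spike]. *)
Lemma dirichlet_sqr N (theta t : R) :
  (dirC N theta t ^+ 2 + dirS N theta t ^+ 2) * (1 - cos theta)
    = 1 - cos (N%:R * theta).
Proof.
have [h1 h2] := dirichlet_telescope N theta t.
have e1 := cos2Dsin2 theta.
have e2 := cos2Dsin2 t.
have e3 := cos2Dsin2 (N%:R * theta + t).
have e4 : cos (N%:R * theta) = cos (N%:R * theta + t) * cos t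
    + sin (N%:R * theta + t) * sin t by rewrite -cosB addrK.
have h : (dirC N theta t - (dirC N theta t * cos theta - dirS N theta t * sin theta)) ^+ 2
  + (dirS N theta t - (dirC N theta t * sin theta + dirS N theta t * cos theta)) ^+ 2
  = (dirC N theta t ^+ 2 + dirS N theta t ^+ 2) *
    (1 - 2 * cos theta + (cos theta ^+ 2 + sin theta ^+ 2)) by ring.
have h' : (cos t - cos (N%:R * theta + t)) ^+ 2 + (sin t - sin (N%:R * theta + t)) ^+ 2
  = (cos t ^+ 2 + sin t ^+ 2) + (cos (N%:R * theta + t) ^+ 2 + sin (N%:R * theta + t) ^+ 2)
    - 2 * (cos (N%:R * theta + t) * cos t + sin (N%:R * theta + t) * sin t) by ring.
move: h; rewrite h1 h2 h' e1 e2 e3 -e4; lra.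
Qed.

(** The Fejer kernel as |1 + z + ... + z^(N-1)|^2 / N on the unit circle, a form in which positivity
    is immediate. *)
Definition fejer N z : R :=
  N%:R^-1 * (dirC N (2 * pi * z) 0 ^+ 2 + dirS N (2 * pi * z) 0 ^+ 2).

Lemma fejer_ge0 N z : 0 <= fejer N z.
Proof. by rewrite mulr_ge0 ?invr_ge0// addr_ge0// sqr_ge0. Qed.

Lemma fejer_small N z : fejer N z * (1 - cos (2 * pi * z)) <= 2 * N%:R^-1.
Proof.
rewrite /fejer -(mulrA N%:R^-1) dirichlet_sqr mulrC ler_wpM2r ?invr_ge0//.
by have := cos_geN1 (N%:R * (2 * pi * z)); lra.
Qed.

(** Expanding the squared modulus leaves only the integer frequencies j - k, so that convolution
    with the kernel yields a trigonometric polynomial. *)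
Lemma fejerE N z : fejer N z =
  N%:R^-1 * \sum_(j < N) \sum_(k < N) cos (2 * pi * (j%:Z - k%:Z)%:~R * z).
Proof.
congr (_ * _); rewrite !expr2 /dirC /dirS !big_distrlr -big_split /=.
apply: eq_bigr => j _; rewrite -big_split /=; apply: eq_bigr => k _.
by rewrite -cosB intrB; congr cos; ring.
Qed.

(** * Real trigonometric polynomials and Fejer means *)

Inductive trigR : (R -> R) -> Prop :=
| trigR0 : trigR (fun=> 0)
| trigR_add c n t f : trigR f ->
    trigR (fun x => c * cos (2 * pi * n%:~R * x + t) + f x).

Lemma trigRD f g : trigR f -> trigR g -> trigR (fun x => f x + g x).
Proof.
move=> + gt; elim=> [|c n t h _ IH].
  by rewrite (_ : (fun x => _) = g)//; apply/funext => x; rewrite add0r.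
under eq_fun do rewrite -addrA; exact: trigR_add.
Qed.

Lemma trigRZ c f : trigR f -> trigR (fun x => c * f x).
Proof.
elim=> [|d n t h _ IH].
  by under eq_fun do rewrite mulr0; exact: trigR0.
under eq_fun do rewrite mulrDr mulrA; exact: trigR_add.
Qed.

Lemma trigR_sum N (F : nat -> R -> R) : (forall k, trigR (F k)) ->
  trigR (fun x => \sum_(k < N) F k x).
Proof.
move=> Ft; elim: N => [|N IH]; under eq_fun do rewrite ?big_ord0 ?big_ord_recr /=.
  exact: trigR0.
exact: trigRD.
Qed.

(** Use 2 cos a = exp(i a) + exp(- i a) for the first pair. For the second, multiply by i, that is,
    add pi/2 to both phases. *)
Lemma trigR_pair f : trigR f ->
  trigV (fun=> True) (fun x => (f x, 0)) /\ trigV (fun=> True) (fun x => (0, f x)).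
Proof.
elim=> [|c n t h _ [IH1 IH2]]; first by split; exact: trigV0.
split.
- have := @trigV_lin _ _ (c / 2) n t _ I (@trigV_lin _ _ (c / 2) (- n) (- t) _ I IH1).
  congr (trigV _ _); apply/funext => x; rewrite /lin /chi /=.
  have -> : 2 * pi * (- n)%:~R * x + - t = - (2 * pi * n%:~R * x + t) by rewrite intrN; ring.
  by rewrite cosN sinN; congr pair; field.
- have := @trigV_lin _ _ (c / 2) n (t + pi / 2) _ I
    (@trigV_lin _ _ (c / 2) (- n) (- t + pi / 2) _ I IH2).
  congr (trigV _ _); apply/funext => x; rewrite /lin /chi /= !addrA.
  have -> : 2 * pi * (- n)%:~R * x + - t = - (2 * pi * n%:~R * x + t) by rewrite intrN; ring.
  by rewrite !sinDpihalf !cosDpihalf cosN sinN; congr pair; field.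
Qed.

Lemma L2_cos (a t : R) : L2_half (fun x => cos (a * x + t)).
Proof.
apply: (@L2_bounded _ _ 1); last by move=> x _; exact: cos_max.
by apply: continuous_measI; exact: continuous_cos_affine.
Qed.

(** The addition formula for cos(a x - a y) separates the variables; the sine terms are written as
    cosines of phase -pi/2 to fit [trigR]. *)
Lemma trigR_conv_cos g n : L2_half g ->
  trigR (fun x => intI (fun y => g y * cos (2 * pi * n%:~R * (x - y)))).
Proof.
move=> g2; set a := 2 * pi * n%:~R : R.
set A := intI (fun y => g y * cos (a * y + 0)).
set B := intI (fun y => g y * cos (a * y + - (pi / 2))).
have i1 := L2_mul g2 (L2_cos a 0); have i2 := L2_mul g2 (L2_cos a (- (pi / 2))).
have := @trigR_add A n 0 _ (@trigR_add B n (- (pi / 2)) _ trigR0).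
congr trigR; apply/funext => x; rewrite -/a [B * _ + 0]addr0.
rewrite (mulrC A) (mulrC B) -(intIZ _ i1) -(intIZ _ i2) -intID; [|exact: itgIZ..].
apply: eq_intI => y _; rewrite !addr0 !cosBpihalf mulrBr cosB; ring.
Qed.

Lemma conv_fejer N g x : L2_half g ->
  itgI (fun y => g y * fejer N (x - y)) /\
  intI (fun y => g y * fejer N (x - y)) = N%:R^-1 * \sum_(j < N) \sum_(k < N)
    intI (fun y => g y * cos (2 * pi * (j%:Z - k%:Z)%:~R * (x - y))).
Proof.
move=> g2.
have i1 (j k : nat) : itgI (fun y => g y * cos (2 * pi * (j%:Z - k%:Z)%:~R * (x - y))).
  have := L2_mul g2 (L2_cos (- (2 * pi * (j%:Z - k%:Z)%:~R))
    (2 * pi * (j%:Z - k%:Z)%:~R * x)).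
  by under eq_fun do rewrite mulNr addrC -mulrBr.
have i2 (j : nat) := intI_sum N (i1 j).
have [i3 e3] := intI_sum N (fun j => (i2 j).1).
have -> : (fun y => g y * fejer N (x - y)) = (fun y => N%:R^-1 *
    \sum_(j < N) \sum_(k < N) g y * cos (2 * pi * (j%:Z - k%:Z)%:~R * (x - y))).
  apply/funext => y; rewrite fejerE mulrCA mulr_sumr; congr (_ * _).
  by apply: eq_bigr => j _; rewrite mulr_sumr.
split; first exact: itgIZ.
by rewrite intIZ// e3; congr (_ * _); apply: eq_bigr => j _; rewrite (i2 j).2.
Qed.

Lemma trigR_conv_fejer N g : L2_half g ->
  trigR (fun x => intI (fun y => g y * fejer N (x - y))).
Proof.
move=> g2; under eq_fun do rewrite (conv_fejer _ _ g2).2.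
apply: trigRZ.
pose F (j k : nat) x := intI (fun y =>
  g y * cos (2 * pi * (j%:Z - k%:Z)%:~R * (x - y))).
apply: (@trigR_sum N (fun j x => \sum_(k < N) F j k x)) => j.
by apply: trigR_sum => k; exact: trigR_conv_cos.
Qed.

Lemma itgI_fejer N x : itgI (fun y => fejer N (x - y)).
Proof.
by have [+ _] := conv_fejer N x (L2_cst 1); under eq_fun do rewrite mul1r.
Qed.

(** Only the N + 1 diagonal terms j = k have a nonzero mean. The index [N.+1] matters: [fejer 0] is
    the zero function. *)
Lemma intI_fejer N x : intI (fun y => fejer N.+1 (x - y)) = 1.
Proof.
have [_] := conv_fejer N.+1 x (L2_cst 1); under eq_fun do rewrite mul1r.
move=> ->.
have -> : \sum_(j < N.+1) \sum_(k < N.+1) intI (fun y => 1 *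
      cos (2 * pi * (j%:Z - k%:Z)%:~R * (x - y))) = \sum_(j < N.+1) (1 : R).
  apply: eq_bigr => j _; rewrite (bigD1 j)//= big1 => [|k kj].
    rewrite addr0 -[RHS]intI_cst; apply: eq_intI => y _.
    by rewrite subrr mulr0z mulr0 mul0r cos0 mulr1.
  have := intI_cos (k%:Z - j%:Z) (2 * pi * (j%:Z - k%:Z)%:~R * x).
  rewrite subr_eq0 eqz_nat (negbTE (kj : val k != val j)) => <-.
  by apply: eq_intI => y _; rewrite mul1r !intrB; congr cos; ring.
by rewrite sumr_const card_ord mulVf// pnatr_eq0.
Qed.

End Fejer.

(** * Density of trigonometric polynomials *)

Section Density.
Variable R : realType.
Local Notation mu := (@lebesgue_measure R).
Local Notation IR := (@Ihalf R : set (measurableTypeR R)).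
Implicit Types (f g : R -> R) (x y z t c M : R) (N : nat).

Lemma ae_Ihalf_interior (P : R -> Prop) :
  (forall x, - (1/2) < x < 1/2 -> P x) -> {ae mu, forall x, IR x -> P x}.
Proof.
move=> HP; exists ([set - (1/2)] `|` [set (1/2 : R)]); split.
- by apply: measurableU; exact: measurable_set1.
- apply: null_set_setU; [exact: measurable_set1|exact: measurable_set1| |];
    exact: lebesgue_measure_set1.
- move=> x /= nP; have [xl|xl] := eqVneq x (- (1/2)); first by left.
  have [xr|xr] := eqVneq x (1/2); first by right.
  exfalso; apply: nP => /IhalfP /andP[x1 x2]; apply: HP.
  by rewrite !lt_neqAle x1 x2 xr eq_sym xl.
Qed.

(** Dominated convergence with pointwise limits asked only at interior points: Fejer means of a
    non-periodic function may miss its values at the endpoints. *)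
Lemma dominated_small (F : nat -> R -> R) (G : R -> R) (e : R) : 0 < e ->
  (forall N, measurable_fun IR (F N)) ->
  (forall N x, Ihalf x -> 0 <= F N x <= G x) -> itgI G ->
  (forall x, - (1/2) < x < 1/2 -> F N x @[N --> \oo] --> 0) ->
  exists N, intI (F N) <= e.
Proof.
move=> e0 mF FG iG F0.
have mF' N : measurable_fun IR (fun x => (F N x)%:E) by exact/measurable_EFinP.
have cF : {ae mu, forall x, IR x -> (F N x)%:E @[N --> \oo] --> (0 : R)%:E}.
  by apply: ae_Ihalf_interior => x xI; apply: cvg_EFin; [exact: nearW|exact: F0].
have dF : {ae mu, forall x N, IR x -> (`|(F N x)%:E| <= (EFin \o G) x)%E}.
  by apply: aeW => x N /(FG N) /andP[h0 h1]; rewrite /= lee_fin ger0_norm.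
have [_ _] := dominated_convergence (@measurable_Ihalf R) mF'
  (measurable_cst (0%:E : \bar R)) cF iG dF.
rewrite integral0 => /fine_cvgP[_ /cvgr0_norm_le/(_ _ e0)[N _ /(_ N (leqnn N)) H]].
by exists N; apply: le_trans (ler_norm _) H.
Qed.

Lemma cos_2pi_le (d z : R) : 0 < d -> d <= z <= 1 - d ->
  cos (2 * pi * z) <= cos (2 * pi * d).
Proof.
(* The symmetry z -> 1 - z reduces to [0, 1/2], where cos(2 pi z) decreases. *)
move=> d0; wlog zh : z / z <= 1/2.
  move=> H /andP[dz zd]; have [zl|zl] := leP z (1/2); first by apply: H => //; rewrite dz.
  have -> : cos (2 * pi * z) = cos (2 * pi * (1 - z)).
    rewrite mulrBr mulr1 cosB (_ : 2 * pi = pi *+ 2) ?mulr2n; last by ring.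
    by rewrite -mulr2n cos2pi sin2pi mul1r mul0r addr0.
  by apply: H; lra.
move=> /andP[dz zd]; have p0 := pi_gt0 R.
rewrite leNgt ltr_cos; first by rewrite -leNgt ler_pM2l// mulr_gt0.
- by rewrite in_itv /=; apply/andP; split; nra.
- by rewrite in_itv /=; apply/andP; split; nra.
Qed.

Lemma cos_2pi_lt1 (d : R) : 0 < d <= 1/2 -> cos (2 * pi * d) < 1.
Proof.
move=> /andP[d0 d1]; have p0 := pi_gt0 R.
rewrite -[ltRHS]cos0 ltr_cos; first by rewrite !mulr_gt0.
- by rewrite in_itv /=; apply/andP; split; nra.
- by rewrite in_itv /=; apply/andP; split; nra.
Qed.

(* [fejer N z * (1 - cos (2 pi z)) <= 2 / N], so the second term is killed by
   integration against the kernel. *)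
Lemma oscillation_bound g x e M : continuous g ->
  (forall y, Ihalf y -> `|g y| <= M) -> - (1/2) < x < 1/2 -> 0 < e ->
  exists2 C, 0 <= C & forall y, Ihalf y ->
    `|g y - g x| <= e + C * (1 - cos (2 * pi * (x - y))).
Proof.
move=> cg gM /andP[xl xr] e0.
have M0 : 0 <= M.
  by apply: le_trans (gM x _) => //; apply/IhalfP/andP; split; exact: ltW.
have /cvgrPdist_lt/(_ _ e0)/nbhs_ballP[d0 /= d0_gt0 Hd0] := cg x.
(* Besides the modulus of continuity at x, d is at most the distance from x to either endpoint, so
   that |x - y| <= 1 - d for every y in the interval and [cos_2pi_le] applies. *)
pose d := Num.min d0 (Num.min (1/2 - x) (1/2 + x)).
have d_gt0 : 0 < d by rewrite !lt_min; apply/and3P; split => //; lra.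
have dd0 : d <= d0 by rewrite ge_min lexx.
have dl : d <= 1/2 - x by rewrite !ge_min lexx orbT.
have dr : d <= 1/2 + x by rewrite !ge_min lexx !orbT.
have c1 : cos (2 * pi * d) < 1 by apply: cos_2pi_lt1; rewrite d_gt0; lra.
(* When |x - y| >= d, the term with this constant is at least 2 M, which bounds |g y - g x|. *)
exists (2 * M / (1 - cos (2 * pi * d))).
  by rewrite divr_ge0 ?mulr_ge0// subr_ge0 ltW.
move=> y Iy; have cle1 := cos_le1 (2 * pi * (x - y)).
have [yd|yd] := ltP `|x - y| d.
  have : `|g x - g y| < e by apply: Hd0; exact: lt_le_trans yd dd0.
  rewrite distrC => /ltW h; apply: le_trans h _; rewrite lerDl mulr_ge0 ?subr_ge0//.
  by rewrite divr_ge0 ?mulr_ge0// subr_ge0 ltW.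
have gyx : `|g y - g x| <= 2 * M.
  apply: le_trans (ler_normB _ _) _; rewrite mulr_natl mulr2n lerD ?gM//.
  by apply/IhalfP/andP; split; exact: ltW.
apply: le_trans gyx _; rewrite -[leLHS]add0r; apply: lerD; first exact: ltW.
rewrite -(mulrA (2 * M)) ler_peMr ?mulr_ge0// mulrC ler_pdivlMr ?subr_gt0// mul1r lerB//.
have -> : cos (2 * pi * (x - y)) = cos (2 * pi * `|x - y|).
  have [_|_] := ger0P (x - y); first by [].
  by rewrite mulrN cosN.
apply: cos_2pi_le => //; rewrite yd /=.
move/IhalfP : Iy => /andP[yl yr].
by rewrite ler_norml; apply/andP; split; lra.
Qed.

Lemma conv_fejer_le N g M x : L2_half g -> (forall y, Ihalf y -> `|g y| <= M) ->
  `|intI (fun y => g y * fejer N.+1 (x - y))| <= M.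
Proof.
move=> g2 gM; rewrite -[leRHS]mulr1 -(intI_fejer N x) -intIZ; last exact: itgI_fejer.
apply: abs_intI_le; [exact: (conv_fejer _ _ g2).1|by apply: itgIZ; exact: itgI_fejer|].
move=> y /gM gy; rewrite normrM [X in _ * X]ger0_norm ?fejer_ge0//.
by rewrite ler_wpM2r// fejer_ge0.
Qed.

Lemma conv_fejer_cvg g M x : continuous g ->
  (forall y, Ihalf y -> `|g y| <= M) -> - (1/2) < x < 1/2 ->
  intI (fun y => g y * fejer N.+1 (x - y)) @[N --> \oo] --> g x.
Proof.
move=> cg gM xI; apply/cvgrPdist_le => e e0.
have g2 : L2_half g by apply: L2_bounded gM; exact: continuous_measI.
have e2 : 0 < e / 2 by rewrite divr_gt0.
have [C C0 HC] := oscillation_bound cg gM xI e2.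
(* Once 1 / (N + 1) < d, the tail C * 2 / (N + 1) is at most e / 2; the summand 1 keeps the
   denominator positive when C = 0. *)
pose d := e / 2 / (2 * C + 1).
have d0 : 0 < d by rewrite divr_gt0// ltr_wpDl// mulr_ge0.
near=> N.
have dN : N.+1%:R^-1 < d.
  by near: N; exact: (near_infty_natSinv_lt (PosNum d0)).
have iK := itgI_fejer N.+1 x; have igK := (conv_fejer N.+1 x g2).1.
rewrite distrC.
have -> : intI (fun y => g y * fejer N.+1 (x - y)) - g x =
    intI (fun y => g y * fejer N.+1 (x - y) + - g x * fejer N.+1 (x - y)).
  by rewrite (intID igK (itgIZ _ iK)) (intIZ _ iK) intI_fejer mulr1.
have iR : itgI (fun y => e / 2 * fejer N.+1 (x - y) + C * (2 * N.+1%:R^-1)).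
  by apply: itgID; [exact: itgIZ|exact: itgI_cst].
apply: (@le_trans _ _ (e / 2 + C * (2 * N.+1%:R^-1))); last first.
  rewrite [leRHS]splitr lerD2l.
  apply: (@le_trans _ _ ((2 * C + 1) * d)); last first.
    by rewrite mulrC divfK// gt_eqF// ltr_wpDl// mulr_ge0.
  rewrite mulrA (mulrC C) ler_pM ?mulr_ge0 ?invr_ge0//; [lra|exact: ltW].
have -> : e / 2 + C * (2 * N.+1%:R^-1) =
    intI (fun y => e / 2 * fejer N.+1 (x - y) + C * (2 * N.+1%:R^-1)).
  by rewrite (intID (itgIZ _ iK) (itgI_cst _)) (intIZ _ iK) intI_fejer mulr1 intI_cst.
apply: abs_intI_le => //; first by apply: itgID => //; exact: itgIZ.
move=> y Iy; rewrite -mulrDl normrM [X in _ * X]ger0_norm ?fejer_ge0//.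
apply: le_trans (ler_wpM2r (fejer_ge0 _ _) (HC y Iy)) _.
rewrite mulrDl lerD2l -(mulrA C) ler_wpM2l// mulrC; exact: fejer_small.
Unshelve. all: by end_near. Qed.

Definition approximable f : Prop := forall e, 0 < e ->
  exists2 p, trigR p & intI (fun x => (f x - p x) ^+ 2) <= e.

Lemma trigR_L2 f : trigR f -> L2_half f.
Proof.
elim=> [|c n t g _ IH]; first exact: L2_cst.
by apply: L2D => //; apply: L2Z; exact: L2_cos.
Qed.

Lemma continuous_norm_fun f : continuous f -> continuous (fun x => `|f x|).
Proof. by move=> cf x; apply: cvg_norm; exact: cf. Qed.

Lemma continuous_Ihalf_bounded g : continuous g ->
  exists M, forall y, Ihalf y -> `|g y| <= M.
Proof.
move=> cg; have [|c _ Hc] := @EVT_max R (fun y => `|g y|) (- (1/2)) (1/2) _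
  (continuous_subspaceT (continuous_norm_fun cg)); first by lra.
by exists `|g c| => y Iy; apply: Hc.
Qed.

Lemma approximable_continuous g : continuous g -> approximable g.
Proof.
move=> cg e e0; have [M gM] := continuous_Ihalf_bounded cg.
have g2 : L2_half g by apply: L2_bounded gM; exact: continuous_measI.
pose s N x := intI (fun y => g y * fejer N.+1 (x - y)).
have st N : trigR (s N) by exact: trigR_conv_fejer.
have [||||N HN] := @dominated_small (fun N x => (g x - s N x) ^+ 2)
   (fun=> (2 * M) ^+ 2) e e0; last by exists (s N).
- by move=> N; case: (L2_sqr (L2B g2 (trigR_L2 (st N)))) => /itgI_measurable.
- move=> N x Ix; rewrite sqr_ge0 /=.
  have M0 : 0 <= M by exact: le_trans (gM x Ix).
  rewrite -[leLHS]real_normK ?num_real// ler_pXn2r ?nnegrE ?mulr_ge0//.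
  apply: le_trans (ler_normB _ _) _; rewrite mulr_natl mulr2n lerD ?gM//.
  exact: conv_fejer_le.
- exact: itgI_cst.
- move=> x xI; have := conv_fejer_cvg cg gM xI.
  move=> /(cvgB (cvg_cst (g x))); rewrite subrr => h.
  under eq_fun do rewrite expr2.
  have := cvgM h h; rewrite mulr0; exact.
Qed.

(** From (a + b)^2 <= 2 a^2 + 2 b^2, two squared errors of e / 4 add up to at most e. *)
Lemma approximable_close f : L2_half f -> (forall e, 0 < e -> exists g,
    [/\ L2_half g, approximable g & intI (fun x => (f x - g x) ^+ 2) <= e]) ->
  approximable f.
Proof.
move=> f2 H e e0; have e4 : 0 < e / 4 by rewrite divr_gt0.
have [g [g2 ga fg]] := H _ e4; have [p pt gp] := ga _ e4; exists p => //.
have p2 := trigR_L2 pt.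
have i1 := L2_sqr (L2B f2 g2); have i2 := L2_sqr (L2B g2 p2).
apply: (@le_trans _ _ (intI (fun x => 2 * (f x - g x) ^+ 2 + 2 * (g x - p x) ^+ 2))).
  apply: le_intI; first exact: (L2_sqr (L2B f2 p2)).
    by apply: itgID; exact: itgIZ.
  by move=> x _; have := sqr_ge0 (f x - g x - (g x - p x)); nra.
rewrite intID; [|exact: itgIZ..]; rewrite !intIZ//; lra.
Qed.

(** For M >= 0 this is the projection onto [-M, M]; the formula by absolute values makes its
    continuity evident. *)
Definition clip M y : R := (`|y + M| - `|y - M|) / 2.

Lemma clip_le M y : 0 <= M -> `|clip M y| <= M.
Proof.
move=> M0; rewrite /clip ler_norml.
by case: (ger0P (y + M)) => h1; case: (ger0P (y - M)) => h2; apply/andP; split; lra.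
Qed.

Lemma clip_id M y : `|y| <= M -> clip M y = y.
Proof.
rewrite ler_norml /clip => /andP[h1 h2].
by rewrite ger0_norm ?ler0_norm; lra.
Qed.

Lemma clip_contract M y z : `|z| <= M -> `|z - clip M y| <= `|z - y|.
Proof.
rewrite ler_norml /clip => /andP[h1 h2].
case: (ger0P (y + M)) => h3; case: (ger0P (y - M)) => h4; case: (ger0P (z - y)) => h5;
  rewrite ler_norml; apply/andP; split; lra.
Qed.

Lemma clip_dist M y : 0 <= M -> `|y - clip M y| <= `|y|.
Proof.
move=> M0; rewrite /clip.
case: (ger0P (y + M)) => h3; case: (ger0P (y - M)) => h4; case: (ger0P y) => h5;
  rewrite ler_norml; apply/andP; split; lra.
Qed.

Lemma continuous_clip M : continuous (clip M).
Proof.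
move=> y; apply: cvgM; last exact: cvg_cst.
by apply: cvgB; apply: cvg_norm; [apply: cvgD|apply: cvgB];
  [exact: cvg_id|exact: cvg_cst|exact: cvg_id|exact: cvg_cst].
Qed.

Lemma measurable_clip M f : measurable_fun IR f ->
  measurable_fun IR (fun x => clip M (f x)).
Proof.
move=> mf; apply: (measurableT_comp _ mf).
by apply: continuous_measurable_fun; exact: continuous_clip.
Qed.

(** Continuous functions approximate f in L^1. Clipping them at M does not increase the distance to
    f, and then |f - h|^2 <= 2 M |f - h| turns L^1 closeness into L^2 closeness. *)
Lemma approximable_bounded f M : measurable_fun IR f ->
  (forall x, Ihalf x -> `|f x| <= M) -> approximable f.
Proof.
move=> mf fM.
have M0 : 0 <= M by apply: le_trans (fM 0 _) => //; apply/IhalfP; lra.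
have f2 := L2_bounded mf fM.
apply: approximable_close => // e e0.
have [||g_ [cg ig /fine_cvgP[_ H]]] :=
  @approximation_continuous_integrable R IR f (@measurable_Ihalf R).
- by rewrite [X in (X < _)%E]mu_Ihalf ltry.
- exact: L2_itg.
have d0 : 0 < e / (2 * M + 1) by rewrite divr_gt0// ltr_wpDl// mulr_ge0.
have /cvgr0_norm_le/(_ _ d0)[N _ /(_ N (leqnn N)) HN] := H.
have ch : continuous (fun x => clip M (g_ N x)).
  by move=> x; apply: continuous_comp; [exact: cg|exact: continuous_clip].
have h2 : L2_half (fun x => clip M (g_ N x)).
  apply: (@L2_bounded _ _ M); first exact: continuous_measI.
  by move=> x _; exact: clip_le.
exists (fun x => clip M (g_ N x)); split => //; first exact: approximable_continuous.
have ia : itgI (fun x => `|f x - g_ N x|).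
  have i0 : itgI (fun x => f x + -1 * g_ N x).
    by apply: itgID; [exact: L2_itg|apply: itgIZ; exact: ig].
  apply: (@itgI_dom _ _ (fun x => `|f x + -1 * g_ N x|)).
  - apply: measurableT_comp => //; apply: measurable_funB => //.
    exact: (itgI_measurable (ig N)).
  - by move=> x _; rewrite normr_id mulN1r.
  - exact: (integrable_norm i0).
apply: (@le_trans _ _ (intI (fun x => 2 * M * `|f x - g_ N x|))).
  apply: le_intI; [exact: (L2_sqr (L2B f2 h2))|exact: itgIZ|].
  move=> x Ix; rewrite -[leLHS]real_normK ?num_real// expr2.
  apply: ler_pM => //; last exact/clip_contract/fM.
  apply: le_trans (ler_normB _ _) _; rewrite mulr_natl mulr2n lerD ?fM//.
  exact: clip_le.
rewrite intIZ//.
have {}HN : intI (fun x => `|f x - g_ N x|) <= e / (2 * M + 1).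
  exact: le_trans (ler_norm _) HN.
have M1 : 0 < 2 * M + 1 by lra.
move: HN; rewrite ler_pdivlMr// => HN.
have i0 : 0 <= intI (fun x => `|f x - g_ N x|) by exact: intI_ge0.
nra.
Qed.

(** The truncations of f at level N are bounded and at each point eventually equal to f; the squared
    errors are dominated by f^2. *)
Lemma approximable_L2 f : L2_half f -> approximable f.
Proof.
move=> f2; have mf := L2_measurable f2.
apply: approximable_close => // e e0.
have mc N := measurable_clip N%:R mf.
have c2 N : L2_half (fun x => clip N%:R (f x)).
  by apply: (@L2_bounded _ _ N%:R) => // x _; exact: clip_le.
have [||||N HN] := @dominated_small (fun N x => (f x - clip N%:R (f x)) ^+ 2)
   (fun x => f x ^+ 2) e e0; last first.
- exists (fun x => clip N%:R (f x)); split => //.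
  by apply: (@approximable_bounded _ N%:R) => // x _; exact: clip_le.
- move=> x _; apply/cvgrPdist_le => d d0; near=> N.
  have fN : `|f x| <= N%:R by near: N; exact: nbhs_infty_ger.
  by rewrite clip_id// subrr expr0n subrr normr0 ltW.
- exact: L2_sqr.
- move=> N x _; rewrite sqr_ge0 /= -[leLHS]real_normK ?num_real//.
  by rewrite -[leRHS]real_normK ?num_real// ler_pXn2r ?nnegrE// clip_dist.
- by move=> N; exact: (itgI_measurable (L2_sqr (L2B f2 (c2 N)))).
Unshelve. all: by end_near. Qed.

Lemma trigV_dense (v : R -> R * R) e : L2V v -> 0 < e ->
  exists2 u, trigV (fun=> True) u & ip (lin (-1) u v) (lin (-1) u v) <= e.
Proof.
move=> [v1 v2] e0; have e2 : 0 < e / 2 by rewrite divr_gt0.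
have [p pt Hp] := approximable_L2 v1 e2.
have [q qt Hq] := approximable_L2 v2 e2.
exists (lin 1 (fun x => (p x, 0)) (fun x => (0, q x))).
  by apply: trigVD; [exact: (trigR_pair pt).1|exact: (trigR_pair qt).2].
rewrite [leRHS]splitr; apply: le_trans (lerD Hp Hq).
rewrite -intID; [|exact: (L2_sqr (L2B v1 (trigR_L2 pt)))|
  exact: (L2_sqr (L2B v2 (trigR_L2 qt)))].
by rewrite le_eqVlt; apply/orP; left; apply/eqP; apply: eq_intI => x _;
  rewrite /dot /lin /=; ring.
Qed.

End Density.

(** * Fourier transforms of pairs *)

Section FourierTransform.
Variable R : realType.
Local Notation mu := (@lebesgue_measure R).
Local Notation IR := (@Ihalf R : set (measurableTypeR R)).
Implicit Types (u v w h : R -> R * R) (x t xi c : R) (n : int).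

Definition mulx u : R -> R * R := fun x => (x * (u x).1, x * (u x).2).

Lemma L2V_mulx u : L2V u -> L2V (mulx u).
Proof.
have mid : measurable_fun IR (fun x : R => x) by exact: measurable_id.
have bid x : Ihalf x -> `|x| <= 1 / 2 by move=> /IhalfP; rewrite ler_norml.
by move=> [u1 u2]; split; [exact: (L2_mulb mid bid u1)|exact: (L2_mulb mid bid u2)].
Qed.

(** Differentiating the character in its frequency multiplies it by 2 pi i x; the factor i appears
    as the phase shift pi/2. *)
Lemma is_derive_dot_chi (a : R * R) x t xi :
  is_derive xi 1 (fun xi => dot a (chi xi t x))
    (2 * pi * (x * dot a (chi xi (t + pi / 2) x))).
Proof.
have dc := is_derive_cos_affine (2 * pi * x) t xi.
have ds := is_derive_sin_affine (2 * pi * x) t xi.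
have -> : (fun xi => dot a (chi xi t x)) =
    (fun xi => a.1 * cos (2 * pi * x * xi + t) + a.2 * sin (2 * pi * x * xi + t)).
  by apply/funext => z; rewrite /dot /chi /= -!mulrA (mulrC z x).
apply: is_derive_eq; rewrite -![_ *: _]/(_ * _) /dot /chi /= !addrA.
rewrite cosDpihalf sinDpihalf.
have -> : 2 * pi * xi * x + t = 2 * pi * x * xi + t by ring.
by ring.
Qed.

Lemma is_derive_ip_chi u t xi : L2V u ->
  is_derive xi 1 (fun xi => ip u (chi xi t))
    (2 * pi * ip (mulx u) (chi xi (t + pi / 2))).
Proof.
move=> u2; have [u21 u22] := u2.
pose F xi x := dot (u x) (chi xi t x).
(* A majorant of the derivative in the frequency, uniform in it because |x| <= 1 on the interval. *)
pose G x := 2 * pi * (`|(u x).1| + `|(u x).2|).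
have dF z x : derivable (F ^~ x) z 1 by case: (is_derive_dot_chi (u x) x t z).
have dFE z x : partial1of2 F z x = 2 * pi * (x * dot (u x) (chi z (t + pi / 2) x)).
  by rewrite partial1of2E; case: (is_derive_dot_chi (u x) x t z).
have p0 : 0 <= 2 * pi :> R by rewrite mulr_ge0// pi_ge0.
have G0 x : 0 <= G x by rewrite mulr_ge0// addr_ge0.
have iG : itgI G.
  by apply: itgIZ; apply: itgID; apply: integrable_norm; exact: L2_itg.
have iF z : `](xi - 1), (xi + 1)[%classic z -> mu.-integrable IR (EFin \o F z).
  by move=> _; exact: (itgI_dot u2 (L2V_chi z t)).
have xiI : `](xi - 1), (xi + 1)[%classic xi by rewrite /= in_itv /=; lra.
have FG z x : `](xi - 1), (xi + 1)[%classic z -> IR x -> `|partial1of2 F z x| <= G x.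
  move=> _ /IhalfP Ix; rewrite dFE normrM ger0_norm// ler_wpM2l// normrM.
  have x1 : `|x| <= 1 by rewrite ler_norml; lra.
  apply: le_trans (ler_pM _ _ x1 (lexx _)) _ => //; rewrite mul1r.
  apply: le_trans (ler_normD _ _) _; rewrite !normrM.
  by apply: lerD; rewrite ler_piMr// ?cos_max ?sin_max.
have D1 := derivable_under_integral (@measurable_Ihalf R) xiI iF
  (fun z x _ _ => dF z x) G0 iG FG.
have D2 := differentiation_under_integral (@measurable_Ihalf R) xiI iF
  (fun z x _ _ => dF z x) G0 iG FG.
apply: DeriveDef; first exact: D1.
rewrite -derive1E; apply: etrans D2 _.
rewrite /ip -intIZ; last exact: (itgI_dot (L2V_mulx u2) (L2V_chi _ _)).
by apply: eq_intI => x _; rewrite dFE; congr (_ * _); rewrite /dot /mulx /=; ring.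
Qed.

Lemma FT_reE (fr fi : R -> R) :
  FT_re fr fi = fun xi => ip (fun x => (fr x, fi x)) (chi xi 0).
Proof.
by apply/funext => xi; apply: eq_intI => x _; rewrite /dot /chi /= addr0.
Qed.

(** The imaginary part of a complex number z is the real part of z times the conjugate of i, hence
    the phase pi/2. *)
Lemma FT_imE (fr fi : R -> R) :
  FT_im fr fi = fun xi => ip (fun x => (fr x, fi x)) (chi xi (pi / 2)).
Proof.
apply/funext => xi; apply: eq_intI => x _; rewrite /dot /chi /=.
by rewrite cosDpihalf sinDpihalf; ring.
Qed.

Lemma ip_chi_pi u xi : L2V u -> ip u (chi xi pi) = - ip u (chi xi 0).
Proof. by move=> u2; rewrite ip_chi_phase// cospi sinpi; ring. Qed.

Lemma derive1_FT_re u xi : L2V u ->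
  derive1 (FT_re (fun x => (u x).1) (fun x => (u x).2)) xi =
  2 * pi * ip (mulx u) (chi xi (pi / 2)).
Proof.
move=> u2; have [_] := is_derive_ip_chi 0 xi u2; rewrite add0r => <-.
rewrite derive1E FT_reE (_ : (fun x => ((u x).1, (u x).2)) = u)//.
by apply/funext => x; case: (u x).
Qed.

Lemma derive1_FT_im u xi : L2V u ->
  derive1 (FT_im (fun x => (u x).1) (fun x => (u x).2)) xi =
  - (2 * pi * ip (mulx u) (chi xi 0)).
Proof.
move=> u2; have [_] := is_derive_ip_chi (pi / 2) xi u2; rewrite -splitr.
rewrite ip_chi_pi; last exact: L2V_mulx.
rewrite mulrN => <-; rewrite derive1E FT_imE (_ : (fun x => ((u x).1, (u x).2)) = u)//.
by apply/funext => x; case: (u x).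
Qed.

End FourierTransform.

(** * Injectivity *)

Section Injectivity.
Variable R : realType.
Local Notation mu := (@lebesgue_measure R).
Local Notation IR := (@Ihalf R : set (measurableTypeR R)).
Implicit Types (u v w h q : R -> R * R) (x t xi c : R) (n : int).

(* Multiplication by [i exp(- 2 pi i x)]. *)
Definition rot u : R -> R * R := fun x =>
  ((u x).1 * sin (2 * pi * x) - (u x).2 * cos (2 * pi * x),
   (u x).1 * cos (2 * pi * x) + (u x).2 * sin (2 * pi * x)).

Lemma L2V_rot u : L2V u -> L2V (rot u).
Proof.
have mc : measurable_fun IR (fun x : R => cos (2 * pi * x + 0)).
  by apply: continuous_measI; exact: continuous_cos_affine.
have ms : measurable_fun IR (fun x : R => sin (2 * pi * x + 0)).
  by apply: continuous_measI; exact: continuous_sin_affine.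
have bc x : Ihalf x -> `|cos (2 * pi * x + 0)| <= 1 by move=> _; exact: cos_max.
have bs x : Ihalf x -> `|sin (2 * pi * x + 0)| <= 1 by move=> _; exact: sin_max.
move=> [u1 u2].
have s1 := L2_mulb ms bs u1; have s2 := L2_mulb ms bs u2.
have c1 := L2_mulb mc bc u1; have c2 := L2_mulb mc bc u2.
split.
- have := L2B s1 c2; congr L2_half; apply/funext => x.
  by rewrite !addr0 mulrC [X in _ - X]mulrC.
- have := L2D c1 s2; congr L2_half; apply/funext => x.
  by rewrite !addr0 mulrC [X in _ + X]mulrC.
Qed.

Lemma rot_lin c u v : rot (lin c u v) = lin c (rot u) (rot v).
Proof. by apply/funext => x; rewrite /rot /lin /=; congr pair; ring. Qed.

Lemma rot_chi n t : rot (chi n%:~R t) = chi (n - 1)%:~R (t + pi / 2).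
Proof.
apply/funext => x; rewrite /rot /chi /= !addrA.
rewrite (_ : 2 * pi * (n - 1)%:~R * x + t = (2 * pi * n%:~R * x + t) - 2 * pi * x);
  last by rewrite intrB; ring.
rewrite cosDpihalf sinDpihalf cosB sinB.
by congr pair; ring.
Qed.

Lemma dot_rot u x : dot (rot u x) (rot u x) = dot (u x) (u x).
Proof.
rewrite /dot /rot /=; have := cos2Dsin2 (2 * pi * x).
set c := cos _; set s := sin _ => cs.
transitivity (((u x).1 ^+ 2 + (u x).2 ^+ 2) * (c ^+ 2 + s ^+ 2)); first by ring.
by rewrite cs; ring.
Qed.

Lemma ip_rot u : ip (rot u) (rot u) = ip u u.
Proof. by apply: eq_intI => x _; exact: dot_rot. Qed.

(** [rot] lowers every frequency by one, so negative frequencies stay negative. *)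
Lemma trigV_rot u : trigV (fun n => n < 0) u -> trigV (fun n => n < 0) (rot u).
Proof.
elim=> [|c n t v n0 _ IH].
  rewrite (_ : rot _ = fun=> (0, 0)); first exact: trigV0.
  by apply/funext => x; rewrite /rot /= !mul0r subrr addr0.
by rewrite rot_lin rot_chi; apply: trigV_lin => //; lra.
Qed.

(** Approximate v by some q with negative frequencies. As [rot q] is orthogonal to u and [rot] is an
    isometry, only the small remainder v - q contributes. *)
Lemma ip_rot_eq0 u v : L2V u -> L2V v ->
  (forall n t, n < 0 -> ip u (chi n%:~R t) = 0) ->
  (forall n t, 0 <= n -> ip v (chi n%:~R t) = 0) -> ip u (rot v) = 0.
Proof.
move=> u2 v2 u0 v0; apply/eqP; apply: contraT => neq0.
set a := `|ip u (rot v)|; have a0 : 0 < a by rewrite normr_gt0.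
pose U := ip u u; have U0 : 0 <= U by exact: ip_ge0.
(* With this weight and the squared error d * (a / 4) for q, both terms of [ip_le_sqr] are at most a
   / 4, which contradicts a > 0. *)
pose d := a / 4 / (U + 1).
have d0 : 0 < d by rewrite !divr_gt0// ltr_wpDl.
have e0 : 0 < d * (a / 4) by rewrite mulr_gt0// divr_gt0.
have [p pt pv] := trigV_dense v2 e0.
have [|q qt qv] := @trigV_project R (fun n => n < 0) v p v2 _ pt.
  by move=> n t; rewrite -leNgt; exact: v0.
have q2 := trigV_L2 qt; set w := lin (-1) q v in qv.
have w2 : L2V w by exact: L2V_lin.
have uq : ip u (rot q) = 0 by apply: (trigV_orth (trigV_rot qt) u2 u0).
have vE : v = lin 1 q w.
  by apply/funext => x; rewrite /w /lin /= [LHS]surjective_pairing; congr pair; ring.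
have : a <= d * U + d^-1 * ip w w.
  rewrite /a {1}vE rot_lin ip_linr//; try exact: L2V_rot.
  rewrite uq mulr0 add0r -(ip_rot w); apply: ip_le_sqr => //; exact: L2V_rot.
have ww : d^-1 * ip w w <= a / 4.
  by rewrite mulrC ler_pdivrMr// mulrC; exact: le_trans qv pv.
have dU : d * U <= a / 4.
  have a4 : 0 <= a / 4 by lra.
  by rewrite /d mulrAC ler_pdivrMr ?ltr_wpDl// ler_wpM2l// lerDl.
lra.
Qed.

Lemma intI_eq0_ae (k : R -> R) : itgI k -> (forall x, Ihalf x -> 0 <= k x) ->
  intI k = 0 -> {ae mu, forall x, IR x -> k x = 0}.
Proof.
move=> ik k0 ik0.
have mk : measurable_fun IR (EFin \o k) by apply/measurable_EFinP; exact: itgI_measurable.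
have : (\int[mu]_(x in IR) `|(EFin \o k) x|)%E = 0%E.
  transitivity (\int[mu]_(x in IR) (k x)%:E)%E; last by rewrite intI_EFin// ik0.
  by apply: eq_integral => x /set_mem Ix /=; rewrite ger0_norm// k0.
move=> /(ae_eq_integral_abs _ (@measurable_Ihalf R) mk).
by apply: filterS => x H Ix; have := H Ix => -[].
Qed.

Lemma intI_ae0 (k : R -> R) : itgI k ->
  {ae mu, forall x, IR x -> k x = 0} -> intI k = 0.
Proof.
move=> ik k0; rewrite -[RHS](intI_cst (0 : R)) /intI /Rintegral; congr fine.
apply: ae_eq_integral => //; first by apply/measurable_EFinP; exact: itgI_measurable.
have [N [mN N0 kN]] := k0; exists N; split => // x /= nH; apply: kN => /= H.
by apply: nH => Ix; rewrite H.
Qed.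

Lemma mul_sin2pi_gt0 x : - (1/2) < x < 1/2 -> x != 0 -> 0 < x * sin (2 * pi * x).
Proof.
move=> /andP[xl xr] x0; have p0 := pi_gt0 R.
have [xn|xp] := ltP x 0.
  rewrite -mulrNN -sinN mulr_gt0 ?oppr_gt0// sin_gt0_pi//.
  by apply/andP; split; nra.
have {}x0 : 0 < x by rewrite lt_neqAle eq_sym x0.
by rewrite mulr_gt0// sin_gt0_pi//; apply/andP; split; nra.
Qed.

Lemma mul_sin2pi_ge0 x : Ihalf x -> 0 <= x * sin (2 * pi * x).
Proof.
move=> /IhalfP /andP[xl xr]; have p0 := pi_gt0 R.
have [xn|xp] := ltP x 0.
  rewrite -mulrNN -sinN mulr_ge0 ?oppr_ge0 ?(ltW xn)// sin_ge0_pi//.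
  by apply/andP; split; nra.
by rewrite mulr_ge0// sin_ge0_pi//; apply/andP; split; nra.
Qed.

Lemma ae_eq0 h : L2V h ->
  (forall n t, 0 <= n -> ip h (chi n%:~R t) = 0) ->
  (forall n t, n < 0 -> ip (mulx h) (chi n%:~R t) = 0) ->
  {ae mu, forall x, IR x -> h x = (0, 0)}.
Proof.
move=> h2 hp hn; have xh2 := L2V_mulx h2.
pose k x := x * sin (2 * pi * x) * dot (h x) (h x).
(* The conjugate of i exp(- 2 pi i x) is - i exp(2 pi i x), whose real part is sin(2 pi x). *)
have kE x : dot (mulx h x) (rot h x) = k x by rewrite /dot /mulx /rot /k /dot /=; ring.
have d0 x : 0 <= dot (h x) (h x) by rewrite /dot -!expr2 addr_ge0// sqr_ge0.
have ik : itgI k.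
  by have := itgI_dot xh2 (L2V_rot h2); under eq_fun do rewrite kE.
have ik0 : intI k = 0.
  by rewrite -(ip_rot_eq0 xh2 h2 hn hp); apply: eq_intI => x _; rewrite kE.
have k0 x : Ihalf x -> 0 <= k x by move=> /mul_sin2pi_ge0 ?; rewrite mulr_ge0.
have H1 := intI_eq0_ae ik k0 ik0.
(* The weight x sin(2 pi x) vanishes on the interval only at 0 and at the endpoints, a null set to
   be discarded. *)
have H2 : {ae mu, forall x, IR x -> - (1/2) < x < 1/2} by exact: ae_Ihalf_interior.
have H3 : {ae mu, forall x : R, x <> 0}.
  exists [set (0 : R)]; split; [exact: measurable_set1|exact: lebesgue_measure_set1|].
  by move=> x /= /contrapT.
have FF : Filter (almost_everywhere mu) by exact: ae_filter_ringOfSetsType.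
apply: (@filterS3 _ (almost_everywhere mu) FF _ _ _ _ _ H1 H2 H3).
move=> x H1x H2x H3x Ix.
have := H1x Ix; rewrite /k => /eqP; rewrite mulf_eq0 gt_eqF /=; last first.
  by apply: mul_sin2pi_gt0; [exact: H2x|exact/eqP].
rewrite /dot -!expr2 paddr_eq0 ?sqr_ge0// !sqrf_eq0 => /andP[/eqP h1 /eqP h2'].
by rewrite [LHS]surjective_pairing h1 h2'.
Qed.

Lemma ip_chi_phase0 u xi t : L2V u -> ip u (chi xi 0) = 0 ->
  ip u (chi xi (pi / 2)) = 0 -> ip u (chi xi t) = 0.
Proof. by move=> u2 h1 h2; rewrite ip_chi_phase// h1 h2 !mulr0 addr0. Qed.

Lemma FT_injective (Fr Fi Gr Gi : R -> R) : in_PW Fr Fi -> in_PW Gr Gi ->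
  (forall n : int, 0 <= n -> Fr n%:~R = Gr n%:~R /\ Fi n%:~R = Gi n%:~R) ->
  (forall n : int, n < 0 -> derive1 Fr n%:~R = derive1 Gr n%:~R /\
                            derive1 Fi n%:~R = derive1 Gi n%:~R) ->
  Fr = Gr /\ Fi = Gi.
Proof.
move=> [fr [fi [fr2 fi2 -> ->]]] [gr [gi [gr2 gi2 -> ->]]] Hp Hn.
pose f x := (fr x, fi x); pose g x := (gr x, gi x).
have f2 : L2V f by []; have g2 : L2V g by [].
pose h := lin (-1) g f; have h2 : L2V h by exact: L2V_lin.
have hE xi t : ip h (chi xi t) = ip f (chi xi t) - ip g (chi xi t).
  by rewrite ip_linl//; [ring|exact: L2V_chi].
have xhE xi t : ip (mulx h) (chi xi t) = ip (mulx f) (chi xi t) - ip (mulx g) (chi xi t).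
  have -> : mulx h = lin (-1) (mulx g) (mulx f).
    by apply/funext => x; rewrite /mulx /h /lin /=; congr pair; ring.
  by rewrite ip_linl//; [ring|exact: L2V_mulx|exact: L2V_mulx|exact: L2V_chi].
have p0 : 2 * pi != 0 :> R by rewrite mulf_neq0// gt_eqF// pi_gt0.
have h0 : {ae mu, forall x, IR x -> h x = (0, 0)}.
  apply: ae_eq0 => // n t n0.
    have [] := Hp n n0; rewrite !FT_reE !FT_imE => e1 e2.
    by apply: ip_chi_phase0 => //; rewrite hE; apply/eqP; rewrite subr_eq0; apply/eqP.
  have [] := Hn n n0; have := derive1_FT_re n%:~R f2; have := derive1_FT_im n%:~R f2.
  have := derive1_FT_re n%:~R g2; have := derive1_FT_im n%:~R g2.
  rewrite /= => -> -> -> -> /(mulfI p0) e1 /oppr_inj /(mulfI p0) e2.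
  apply: ip_chi_phase0; first exact: L2V_mulx.
    by rewrite xhE e2 subrr.
  by rewrite xhE e1 subrr.
(* Almost everywhere equality of f and g already gives equal transforms at every point, since these
   are integrals. *)
have fg xi t : ip f (chi xi t) = ip g (chi xi t).
  apply/eqP; rewrite -subr_eq0 -hE; apply/eqP; apply: intI_ae0.
    exact: (itgI_dot h2 (L2V_chi _ _)).
  have FF : Filter (almost_everywhere mu) by exact: ae_filter_ringOfSetsType.
  apply: (@filterS _ (almost_everywhere mu) FF _ _ _ h0) => x H Ix.
  by rewrite H// /dot /= !mul0r addr0.
by rewrite !FT_reE !FT_imE; split; apply/funext => xi; exact: fg.
Qed.

End Injectivity.

(** * Instability *)

Section Instability.
Variable R : realType.
Local Notation mu := (@lebesgue_measure R).
Local Notation TR := (measurableTypeR R).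
Implicit Types (u v w : R -> R * R) (x t xi c : R) (n : int) (j k K N : nat).

(** Here and below a natural number k stands for the frequency -(k + 1), as in [sample_energy]. *)
Lemma chi_negE k t : chi (- k.+1%:R) t = chi (- k.+1%:Z)%:~R t :> (R -> R * R).
Proof. by rewrite intrN. Qed.

Lemma ip_chi_neg j k t s : ip (chi (- j.+1%:R : R) t) (chi (- k.+1%:R) s) =
  if j == k then cos (t - s) else 0.
Proof. by rewrite !chi_negE ip_chi eqr_opp eqz_nat eqSS. Qed.

(* The induction removes from [u] its components of frequencies [-1, ..., -K],
   and tracks the square norm of what is left. *)
Lemma bessel_neg u K : L2V u ->
  \sum_(k < K) (ip u (chi (- k.+1%:R) 0) ^+ 2 +
                ip u (chi (- k.+1%:R) (pi / 2)) ^+ 2) <= ip u u.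
Proof.
move=> u2; pose S K := \sum_(k < K) (ip u (chi (- k.+1%:R) 0) ^+ 2 +
                ip u (chi (- k.+1%:R) (pi / 2)) ^+ 2).
suff [w [_ + _]] : exists w, [/\ L2V w, ip w w = ip u u - S K & forall j t,
    (K <= j)%N -> ip w (chi (- j.+1%:R) t) = ip u (chi (- j.+1%:R) t)].
  by move=> e; have := ip_ge0 w; rewrite e subr_ge0.
elim: K => [|K [w [w2 we wc]]].
  by exists u; split => //; rewrite /S big_ord0 subr0.
(* An orthonormal pair for the real inner product, spanning the complex line of frequency -(K +
   1). *)
pose e := chi (- K.+1%:R : R) 0; pose e' := chi (- K.+1%:R : R) (pi / 2).
have e2 : L2V e by exact: L2V_chi.
have e'2 : L2V e' by exact: L2V_chi.
have ee : ip e e = 1 by rewrite ip_chi_neg eqxx subrr cos0.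
have e'e' : ip e' e' = 1 by rewrite ip_chi_neg eqxx subrr cos0.
have ee' : ip e e' = 0 by rewrite ip_chi_neg eqxx sub0r cosN cos_pihalf.
have wE : ip w e = ip u e by exact: wc.
have wE' : ip w e' = ip u e' by exact: wc.
pose w1 := lin (- ip u e') e' w; have w12 : L2V w1 by exact: L2V_lin.
have w1e : ip w1 e = ip u e by rewrite ip_linl// (ipC e' e) ee' wE; ring.
have w1w1 : ip w1 w1 = ip w w - ip u e' ^+ 2.
  by rewrite /w1 ip_linl// !ip_linr// (ipC e' w) e'e' wE'; ring.
exists (lin (- ip u e) e w1); split; first exact: L2V_lin.
  have -> : S K.+1 = S K + (ip u e ^+ 2 + ip u e' ^+ 2) by rewrite /S big_ord_recr.
  clearbody w1; rewrite ip_linl//; last exact: L2V_lin.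
  by rewrite !ip_linr// (ipC e w1) ee w1e w1w1 we; ring.
move=> j t Kj; have cj := L2V_chi (- j.+1%:R : R) t.
rewrite !ip_linl// !ip_chi_neg ltn_eqF// wc ?(ltnW Kj)//; ring.
Qed.

(** By the mean value theorem sin z = z cos c for some c < z, and cos decreases on [0, pi]. *)
Lemma sin_ge_mul_cos (z : R) : 0 <= z <= pi -> z * cos z <= sin z.
Proof.
move=> /andP[]; rewrite le_eqVlt => /predU1P[<- _|z0 zp]; first by rewrite mul0r sin0.
have [|c] := @MVT R (@sin R) (@cos R) 0 z z0 (fun x _ => is_derive_sin x).
  by apply: continuous_subspaceT => x; exact: continuous_sin.
rewrite in_itv /= sin0 !subr0 => /andP[c0 cz] ->.
rewrite mulrC ler_wpM2r ?(ltW z0)// ltW// ltr_cos//; rewrite in_itv /=; lra.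
Qed.

(** sin y = 2 sin(y/2) cos(y/2) >= y cos(y/2)^2, and cos(y/2)^2 = (1 + cos y) / 2 >= 1/2. *)
Lemma sin_ge_half (y : R) : 0 <= y <= pi / 2 -> y / 2 <= sin y.
Proof.
move=> /andP[y0 yp]; have p0 := pi_gt0 R.
have h : y / 2 * cos (y / 2) <= sin (y / 2) by apply: sin_ge_mul_cos; lra.
have c0 : 0 <= cos (y / 2) by apply: cos_ge0_pihalf; lra.
have cy : 0 <= cos y by apply: cos_ge0_pihalf; lra.
have e1 : sin y = 2 * (sin (y / 2) * cos (y / 2)).
  by rewrite {1}[y]splitr sinD; ring.
have e2 : cos y = 2 * cos (y / 2) ^+ 2 - 1.
  by rewrite {1}[y]splitr cosD -!expr2 sin2cos2; ring.
by rewrite e1; nra.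
Qed.

(** 1 - cos(2 pi x) = 2 sin(pi x)^2, and for x >= 0 one has sin(pi x) >= pi x / 2 >= x. *)
Lemma sqr_le_1Bcos x : Ihalf x -> 2 * x ^+ 2 <= 1 - cos (2 * pi * x).
Proof.
move=> /IhalfP Ix.
have p2 : 2 <= pi :> R by exact: pi_ge2.
wlog x0 : x Ix / 0 <= x.
  move=> H; have [?|?] := leP 0 x; first exact: H.
  by have := H (- x); rewrite sqrrN mulrN cosN; apply; lra.
have h : pi * x / 2 <= sin (pi * x) by apply: sin_ge_half; apply/andP; split; nra.
have -> : cos (2 * pi * x) = 1 - 2 * sin (pi * x) ^+ 2.
  have -> : 2 * pi * x = pi * x + pi * x by ring.
  by rewrite cosD -!expr2 cos2sin2; ring.
have : x <= sin (pi * x) by apply: le_trans h; nra.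
by nra.
Qed.

(** A one-sided Dirichlet kernel: its mass concentrates at 0, where the factor x seen by the
    derivative samples vanishes. *)
Fixpoint spike N : R -> R * R :=
  if N is N'.+1 then lin 1 (chi (- N%:R) 0) (spike N') else fun=> (0, 0).

Lemma spike_trigV N : trigV (fun n => n < 0) (spike N).
Proof.
elim: N => [|N IH]; first exact: trigV0.
by rewrite [spike _]/= chi_negE; apply: trigV_lin.
Qed.

Lemma L2V_spike N : L2V (spike N).
Proof. exact: trigV_L2 (spike_trigV N). Qed.

(** The phase 2 pi x shifts the frequencies 0, ..., N - 1 of the Dirichlet sums to 1, ..., N; the
    minus sign is the conjugation that makes them negative. *)
Lemma spikeE N x : spike N x =
  (dirC N (2 * pi * x) (2 * pi * x), - dirS N (2 * pi * x) (2 * pi * x)).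
Proof.
rewrite /dirC /dirS; elim: N => [|N IH]; first by rewrite !big_ord0 oppr0.
rewrite [LHS]/= /lin IH !big_ord_recr /= /chi /= addr0.
have -> : 2 * pi * - N.+1%:R * x = - (N%:R * (2 * pi * x) + 2 * pi * x).
  by rewrite -natr1; ring.
by rewrite cosN sinN; congr pair; ring.
Qed.

(** By [dirichlet_sqr], |f|^2 (1 - cos(2 pi x)) = 1 - cos(2 pi N x) <= 2, while 2 x^2 <= 1 - cos(2
    pi x). *)
Lemma mulx_spike_le N x : Ihalf x ->
  dot (mulx (spike N) x) (mulx (spike N) x) <= 1.
Proof.
move=> Ix; rewrite /mulx spikeE /dot /=.
have := dirichlet_sqr N (2 * pi * x) (2 * pi * x).
have := cos_geN1 (N%:R * (2 * pi * x)).
have := sqr_le_1Bcos Ix.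
set C := dirC _ _ _; set S := dirS _ _ _; move=> h1 h2 h3.
have h4 := ler_wpM2l (addr_ge0 (sqr_ge0 C) (sqr_ge0 S)) h1.
have -> : x * C * (x * C) + x * - S * (x * - S) = (C ^+ 2 + S ^+ 2) * x ^+ 2 by ring.
move: h4; rewrite h3 mulrCA; lra.
Qed.

Lemma ip_spike_ge0 N n t : 0 <= n -> ip (spike N) (chi n%:~R t) = 0.
Proof.
move=> n0; rewrite ipC; apply: (trigV_orth (spike_trigV N)); first exact: L2V_chi.
by move=> m s m0; rewrite ip_chi gt_eqF//; exact: lt_le_trans n0.
Qed.

Lemma ip_spike_neg N k : ip (spike N) (chi (- k.+1%:R) 0) = (k < N)%:R.
Proof.
have ck := L2V_chi (- k.+1%:R : R) 0.
elim: N => [|N IH]; first by rewrite ipC ip0r.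
rewrite [spike _]/= ip_linl//; [|exact: L2V_chi|exact: L2V_spike].
rewrite IH ip_chi_neg subrr cos0 mul1r eq_sym.
have [->|kN] := eqVneq k N; first by rewrite ltnn ltnSn addr0.
by rewrite add0r (ltnS k N) [in RHS]leq_eqVlt (negbTE kN).
Qed.

Definition spikeFr N := FT_re (fun x => (spike N x).1) (fun x => (spike N x).2).
Definition spikeFi N := FT_im (fun x => (spike N x).1) (fun x => (spike N x).2).

Lemma spikeFrE N : spikeFr N = fun xi => ip (spike N) (chi xi 0).
Proof.
rewrite /spikeFr FT_reE (_ : (fun x => ((spike N x).1, (spike N x).2)) = spike N)//.
by apply/funext => x; case: (spike N x).
Qed.

Lemma spikeFiE N : spikeFi N = fun xi => ip (spike N) (chi xi (pi / 2)).
Proof.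
rewrite /spikeFi FT_imE (_ : (fun x => ((spike N x).1, (spike N x).2)) = spike N)//.
by apply/funext => x; case: (spike N x).
Qed.

Lemma in_PW_spike N : in_PW (spikeFr N) (spikeFi N).
Proof.
exists (fun x => (spike N x).1), (fun x => (spike N x).2).
by have [? ?] := L2V_spike N.
Qed.

Lemma sample_energy_spike N : (sample_energy (spikeFr N) (spikeFi N) <= 1)%E.
Proof.
rewrite /sample_energy eseries0; last first.
  move=> n _ _; have n0 : (0 : int) <= n%:Z by [].
  have e t : ip (spike N) (chi n%:R t) = 0 by exact: (ip_spike_ge0 N t n0).
  by rewrite /cabs2 spikeFrE spikeFiE !e expr0n addr0.
rewrite add0r; have s2 := L2V_spike N; have xs2 := L2V_mulx s2.
have dE k : dabs2 (spikeFr N) (spikeFi N) (- k.+1%:R) =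
    ip (mulx (spike N)) (chi (- k.+1%:R) 0) ^+ 2 +
    ip (mulx (spike N)) (chi (- k.+1%:R) (pi / 2)) ^+ 2.
  rewrite /dabs2 derive1_FT_re// derive1_FT_im//.
  have : 2 * pi != 0 :> R by rewrite mulf_neq0// gt_eqF// pi_gt0.
  move: (2 * pi : R) => P P0.
  by rewrite sqrrN !exprMn -mulrDr mulrC mulKf ?expf_neq0// addrC.
apply: lime_le.
  by apply: is_cvg_nneseries => k _ _; rewrite lee_fin dE addr_ge0// sqr_ge0.
apply: nearW => K; rewrite sumEFin lee_fin big_mkord.
under eq_bigr do rewrite dE.
apply: le_trans (bessel_neg K xs2) _.
rewrite -[leRHS](intI_cst (1 : R)); apply: le_intI.
- exact: itgI_dot.
- exact: itgI_cst.
- by move=> x; exact: mulx_spike_le.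
Qed.

Lemma dot_unit_le (a b : R * R) : dot a a <= 1 -> dot b b = 1 -> `|dot a b| <= 1.
Proof.
move=> a1 b1; rewrite -[leRHS](normr1 R) -ler_sqr ?nnegrE// !real_normK ?num_real//.
have e : dot a b ^+ 2 + (a.1 * b.2 - a.2 * b.1) ^+ 2 = dot a a * dot b b.
  by rewrite /dot; ring.
move: e; rewrite b1 mulr1 expr1n; have := sqr_ge0 (a.1 * b.2 - a.2 * b.1); lra.
Qed.

Lemma is_derive_spikeFr N xi : is_derive xi 1 (spikeFr N)
  (2 * pi * ip (mulx (spike N)) (chi xi (pi / 2))).
Proof.
rewrite spikeFrE; have := is_derive_ip_chi 0 xi (L2V_spike N); by rewrite add0r.
Qed.

Lemma is_derive_spikeFi N xi : is_derive xi 1 (spikeFi N)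
  (2 * pi * ip (mulx (spike N)) (chi xi (pi / 2 + pi / 2))).
Proof. rewrite spikeFiE; exact: (is_derive_ip_chi (pi / 2) xi (L2V_spike N)). Qed.

Lemma is_derive_continuous (f df : R -> R) :
  (forall x : R, is_derive x 1 f (df x)) -> continuous f.
Proof.
move=> H x; apply: differentiable_continuous; apply/derivable1_diffP.
by case: (H x).
Qed.

Lemma continuous_spikeFr N : continuous (spikeFr N).
Proof. exact: is_derive_continuous (is_derive_spikeFr N). Qed.

Lemma continuous_spikeFi N : continuous (spikeFi N).
Proof. exact: is_derive_continuous (is_derive_spikeFi N). Qed.

(** The integrand is the product of a pair of norm at most 1 with a unit pair; the bound does not
    depend on N. *)
Lemma derive_spikeFr_le N xi : `|2 * pi * ip (mulx (spike N)) (chi xi (pi / 2))| <= 2 * pi.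
Proof.
have p0 : 0 <= 2 * pi :> R by rewrite mulr_ge0// pi_ge0.
rewrite normrM ger0_norm// ler_piMr//.
rewrite -[leRHS](intI_cst (1 : R)); apply: abs_intI_le.
- exact: (itgI_dot (L2V_mulx (L2V_spike N)) (L2V_chi _ _)).
- exact: itgI_cst.
move=> x Ix; apply: dot_unit_le; first exact: mulx_spike_le.
by rewrite /dot /chi /= -!expr2 cos2Dsin2.
Qed.

(** The value at the left end is 1 and the slope is at least -2 pi > -8, so over a length 1/16 the
    function loses at most 1/2. *)
Lemma spikeFr_ge N k xi : (k < N)%N -> - k.+1%:R <= xi <= - k.+1%:R + 1 / 16 ->
  1 / 2 <= spikeFr N xi.
Proof.
move=> kN /andP[]; set a := - k.+1%:R => ax xa.
have Fa : spikeFr N a = 1 by rewrite spikeFrE ip_spike_neg kN.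
move: ax; rewrite le_eqVlt => /predU1P[<-|ax]; first by rewrite Fa; lra.
have [|c _ Hc] := MVT ax (fun x _ => is_derive_spikeFr N x).
  by apply: continuous_subspaceT => x; exact: continuous_spikeFr.
have := derive_spikeFr_le N c; move: Hc; set D := 2 * pi * ip _ _ => Hc.
rewrite ler_norml => /andP[D1 _]; have p4 : pi / 2 < 2 :> R by exact: pihalf_lt2.
by rewrite Fa in Hc; nra.
Qed.

Definition window k : set TR := `[(- k.+1%:R : R), - k.+1%:R + 1 / 16]%classic.

Lemma window_trivIset (D : set nat) : trivIset D window.
Proof.
apply/trivIsetP => i j _ _; wlog ij : i j / (i < j)%N.
  move=> H nij; have [ij|ij] := ltnP i j; first exact: H.
  rewrite setIC; apply: H; last by rewrite eq_sym.
  by rewrite ltn_neqAle eq_sym nij.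
move=> _; apply/seteqP; split => // x [].
rewrite /window /= !in_itv /= => /andP[h1 _] /andP[_ h2].
have : i.+1%:R + 1 <= j.+1%:R :> R by rewrite natr1 ler_nat.
lra.
Qed.

Lemma measurable_window k : measurable (window k).
Proof. exact: measurable_itv. Qed.

Lemma mu_window k : mu (window k) = (1 / 16)%:E.
Proof.
rewrite /window lebesgue_measure_itv /= lte_fin ifT; last by lra.
by rewrite -EFinB; congr (_%:E); lra.
Qed.

Lemma L2norm2_spike N : ((N%:R / 64)%:E <= L2norm2 (spikeFr N) (spikeFi N))%E.
Proof.
pose g := (fun x : TR => (cabs2 (spikeFr N) (spikeFi N) x)%:E).
have mg (D : set TR) : measurable_fun D g.
  apply: measurable_funTS; apply/measurable_EFinP; apply: measurable_funD.
    by apply: measurable_funX; apply: continuous_measurable_fun; exact: continuous_spikeFr.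
  by apply: measurable_funX; apply: continuous_measurable_fun; exact: continuous_spikeFi.
have g0 x : (0 <= g x)%E by rewrite lee_fin addr_ge0// sqr_ge0.
pose D := \big[setU/set0]_(k <- iota 0 N) window k.
have mD : measurable D.
  by apply: bigsetU_measurable => k _; exact: measurable_window.
apply: (@le_trans _ _ (\int[mu]_(x in D) g x)%E); last first.
  by apply: ge0_subset_integral => // x _; exact: g0.
rewrite (ge0_integral_bigsetU mu measurable_window (iota_uniq 0 N)
  (@window_trivIset _) (mg _) (fun x _ => g0 x)).
have -> : (N%:R / 64)%:E = \sum_(k <- iota 0 N) (1 / 64 : R)%:E.
  rewrite sumEFin; congr (_%:E).
  by rewrite big_const_seq count_predT size_iota iter_addr_0 -[RHS]mulr_natl mul1r.
rewrite big_seq [leRHS]big_seq; apply: lee_sum => k.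
rewrite mem_iota add0n => /andP[_ kN].
(* On a window of length 1/16 the integrand is at least (1/2)^2, hence the contribution 1/64 of each
   window. *)
apply: (@le_trans _ _ (\int[mu]_(x in window k) cst (1 / 4 : R)%:E x)%E).
  rewrite integral_cst; last exact: measurable_window.
  by rewrite [X in (_ <= _ * X)%E]mu_window -EFinM lee_fin; lra.
apply: ge0_le_integral.
- exact: measurable_window.
- by move=> x _; rewrite lee_fin; lra.
- exact: measurable_cst.
- exact: mg.
move=> x; rewrite /window /= in_itv /= => /(spikeFr_ge kN) h.
by rewrite /g lee_fin /cabs2; have := sqr_ge0 (spikeFi N x); nra.
Qed.

Lemma sampling_unstable : ~ (exists c : R, 0 < c /\
  forall Fr Fi : R -> R, in_PW Fr Fi ->
    (c%:E * L2norm2 Fr Fi <= sample_energy Fr Fi)%E).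
Proof.
move=> [c [c0 H]].
(* This choice makes c N / 64 exceed 1, the bound on the sample energy. *)
pose N := Num.Def.archi_bound (64 / c).
have HN : 64 / c < N%:R by apply: archi_boundP; rewrite divr_ge0// ltW.
have := le_trans (H _ _ (in_PW_spike N)) (sample_energy_spike N).
have c0' : (0 <= c%:E)%E by rewrite lee_fin ltW.
move=> /(le_trans (lee_wpmul2l c0' (L2norm2_spike N))).
rewrite -EFinM lee_fin => h.
by move: HN; rewrite ltr_pdivrMr// => HN; lra.
Qed.

End Instability.

Theorem mainTheorem9 (R : realType) :
  (forall Fr Fi Gr Gi : R -> R, in_PW Fr Fi -> in_PW Gr Gi ->
     (forall n : int, 0 <= n ->
        Fr n%:~R = Gr n%:~R /\ Fi n%:~R = Gi n%:~R) ->
     (forall n : int, n < 0 ->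
        derive1 Fr n%:~R = derive1 Gr n%:~R /\ derive1 Fi n%:~R = derive1 Gi n%:~R) ->
     Fr = Gr /\ Fi = Gi)
  /\
  ~ (exists c : R, 0 < c /\
       forall Fr Fi : R -> R, in_PW Fr Fi ->
         (c%:E * L2norm2 Fr Fi <= sample_energy Fr Fi)%E).
Proof.
by split; [move=> Fr Fi Gr Gi; exact: FT_injective|exact: sampling_unstable].
Qed.
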